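(* Suppose there exists an algorithm solving Generalized $T$-Coloring in time (i) $2^{2^{o(\sqrt{n})}}\,\mathrm{poly}(r)$, or (ii) $2^{n\cdot o(\log l/(\log\log l)^2)}\,\mathrm{poly}(r)$, where $n$ is the number of vertices of the input graph, $r$ is the bit size of the input, and $l$ is the largest forbidden distance in the instance, i.e.\ $l=\max\bigcup_{e\in E}t(e)$. Then there exists an algorithm solving Dominating Set on $n$-vertex graphs in time $2^{o(n)}$.
   Context: $\mathbb{N}=\{0,1,2,\dots\}$. An instance of Generalized $T$-Coloring is a triple $(G,t,s)$ where $G=(V,E)$ is a graph, $t:E\to 2^{\mathbb{N}}$ assigns to each edge a set of forbidden distances, and $s\in\mathbb{N}$. An assignment $c:V\to\{1,\dots,s\}$ is proper if $|c(u)-c(v)|\notin t(uv)$ for every edge $uv\in E$. The question is whether a proper assignment exists. The bit size of an instance includes all bits needed to represent the sets $t(e)$, $e\in E$, and $s$. Dominating Set: given a graph $G$ and an integer $k$, decide whether $G$ has a set $D$ of at most $k$ vertices such that every vertex is in $D$ or adjacent to a vertex of $D$. *)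

(* Defs.v *)
From mathcomp Require Import all_boot all_order all_algebra finmap.
From mathcomp Require Import reals.

Set Implicit Arguments.
Unset Strict Implicit.
Unset Printing Implicit Defensive.

(* Model of computation: Jones's WHILE language over binary trees (Computability
   and Complexity from a Programming Perspective), with unit-cost operations.
   Trees can be shared, and a program inspects them only through [hd], [tl] and
   tests against [Nil], so the model and multi-tape Turing machines simulate
   each other with polynomial overhead. *)

Inductive tree := Nil | Cons of tree & tree.

Definition hd t := if t is Cons a _ then a else Nil.
Definition tl t := if t is Cons _ b then b else Nil.
Definition truth t := if t is Cons _ _ then true else false.

Inductive expr :=
  | Var of nat
  | ENil
  | ECons of expr & expr
  | EHd of expr
  | ETl of expr.

Inductive cmd :=
  | Assign of nat & expr
  | Seq of cmd & cmd
  | If of expr & cmd & cmd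
  | While of expr & cmd.

Definition store := nat -> tree.

Definition upd (s : store) (x : nat) (t : tree) : store :=
  fun y => if y == x then t else s y.

Fixpoint eval (s : store) (e : expr) : tree :=
  match e with
  | Var x => s x
  | ENil => Nil
  | ECons a b => Cons (eval s a) (eval s b)
  | EHd a => hd (eval s a)
  | ETl a => tl (eval s a)
  end.

Fixpoint ecost (e : expr) : nat :=
  match e with
  | Var _ | ENil => 1
  | ECons a b => (ecost a + ecost b).+1
  | EHd a | ETl a => (ecost a).+1
  end.

(* [exec s c s' T]: from store [s], [c] terminates in store [s'] in exactly
   [T] steps. *)
Inductive exec : store -> cmd -> store -> nat -> Prop :=
  | XAssign s x e :
      exec s (Assign x e) (upd s x (eval s e)) (ecost e).+1
  | XSeq s s1 s2 c d T U :
      exec s c s1 T -> exec s1 d s2 U -> exec s (Seq c d) s2 (T + U)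
  | XIfTrue s s1 e c d T :
      truth (eval s e) -> exec s c s1 T ->
      exec s (If e c d) s1 (ecost e + T).+1
  | XIfFalse s s1 e c d T :
      ~~ truth (eval s e) -> exec s d s1 T ->
      exec s (If e c d) s1 (ecost e + T).+1
  | XWhileFalse s e c :
      ~~ truth (eval s e) -> exec s (While e c) s (ecost e).+1
  | XWhileTrue s s1 s2 e c T U :
      truth (eval s e) -> exec s c s1 T -> exec s1 (While e c) s2 U ->
      exec s (While e c) s2 (ecost e + T + U).+1.

Definition tree_of_bool (b : bool) : tree := if b then Cons Nil Nil else Nil.

Definition tree_of_bits (w : seq bool) : tree :=
  foldr (fun b t => Cons (tree_of_bool b) t) Nil w.

(* Variable 0 holds the input bit string at the start and the answer at the
   end; all other variables start at [Nil]. *)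
Definition init (w : seq bool) : store := upd (fun=> Nil) 0 (tree_of_bits w).

Definition outputs (A : cmd) (w : seq bool) (b : bool) (T : nat) : Prop :=
  exists2 s', exec (init w) A s' T & truth (s' 0) = b.

Definition solves_in_time (R : realType) (X : Type) (A : cmd)
    (code : X -> seq bool) (yes : X -> Prop) (time : X -> R) : Prop :=
  forall x : X, exists b T,
    [/\ outputs A (code x) b T, b <-> yes x & (T%:R <= time x)%R].

(* Binary expansion, least significant bit first, without leading zeros
   (except that 0 is [:: false]). *)
Definition bits (n : nat) : seq bool :=
  [seq odd (n %/ 2 ^ i) | i <- iota 0 (trunc_log 2 n).+1].

(* Self-delimiting codes: every item is announced by a [true], the end of the
   list by a [false]. *)
Definition code_list (T : Type) (code : T -> seq bool) (s : seq T) : seq bool :=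
  flatten [seq true :: code x | x <- s] ++ [:: false].

Definition code_nat (n : nat) : seq bool := code_list (fun b => [:: b]) (bits n).

Record graph := Graph {
  nverts : nat;
  adj : rel 'I_nverts;
  adj_sym : symmetric adj;
  adj_irr : irreflexive adj
}.

Definition pairs (n : nat) : seq ('I_n * 'I_n) :=
  [seq p : 'I_n * 'I_n <- [seq (u, v) | u <- enum 'I_n, v <- enum 'I_n]
     | p.1 < p.2].

(* An edge uv is the two-element set [set u; v]; the values of [forbidden]
   on sets that are not edges are never used. *)
Record gtc := Gtc {
  gtc_graph :> graph;
  forbidden : {set 'I_(nverts gtc_graph)} -> {fset nat};
  colors : nat
}.

Definition proper_assignment (I : gtc) (c : 'I_(nverts I) -> nat) : Prop :=
  forall u v, adj u v -> absz ((c u)%:Z - (c v)%:Z)%R \notin forbidden [set u; v].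

Definition gtc_yes (I : gtc) : Prop :=
  exists2 c : 'I_(nverts I) -> nat,
    forall v, 1 <= c v <= colors I & proper_assignment c.

(* Equal to 0 when nothing is forbidden. *)
Definition max_forbidden (I : gtc) : nat :=
  \max_(p : 'I_(nverts I) * 'I_(nverts I) | adj p.1 p.2)
    \max_(d <- forbidden [set p.1; p.2]) d.

(* Numbers are in binary, and a forbidden set is the increasing list of its
   elements. *)
Definition gtc_code (I : gtc) : seq bool :=
  code_nat (nverts I) ++ code_nat (colors I) ++
  flatten [seq if adj p.1 p.2
               then true :: code_list code_nat
                              (sort leq (forbidden [set p.1; p.2]))
               else [:: false]
          | p <- pairs (nverts I)].

Definition bit_size (I : gtc) : nat := size (gtc_code I).

Definition dominating (G : graph) (D : {set 'I_(nverts G)}) : Prop :=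
  forall v, v \in D \/ exists2 u, u \in D & adj u v.

Definition ds_yes (J : graph * nat) : Prop :=
  exists2 D : {set 'I_(nverts J.1)}, #|D| <= J.2 & dominating D.

Definition ds_code (J : graph * nat) : seq bool :=
  code_nat (nverts J.1) ++ [seq adj p.1 p.2 | p <- pairs (nverts J.1)] ++
  code_nat J.2.

(* Main.v *)
From mathcomp Require Import all_boot all_order all_algebra finmap.
From mathcomp Require Import all_classical all_reals all_analysis.
From mathcomp Require Import zify ring lra.
Require Import Defs.
Set Implicit Arguments.
Unset Strict Implicit.
Unset Printing Implicit Defensive.


(** Fix a graph on [n] vertices and let [b] be slightly more than log2 [n].  A
    dominating set is an ordered list of [k] vertices; cut it into [K = b ^ 2]
    blocks of [q ~ 2 ^ b / b ^ 2] entries, and let [a_i], a string of [w = q * b]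
    bits, hold the [i]-th block.  Cut the vertices into [K] blocks as well, and
    let [c_j] hold, for each vertex of the [j]-th block, the position in the
    list of a vertex that dominates it.  That these strings describe a
    dominating set is a condition on the pairs ([c_j], [a_i]) only.  With
    [D = 2 ^ w], give the vertex [i] the color [D - a_i] and the vertex [K + j]
    the color [D + D * c_j]: their distance [D * c_j + a_i] determines both
    strings, so the condition becomes a set of forbidden distances below
    [D ^ 2].  Two further vertices, forced to the extreme colors [1] and
    [D ^ 2], fix the origin and the orientation and confine the others to the
    colors of the above form.

    The instance has [N = 2 * b ^ 2 + 2] vertices, forbidden distances up to
    [l = D ^ 2 - 1] and size [2 ^ O(w)], where [w = O(n / log n)].  Hence
    [2 ^ o(sqrt N)] is at most [sqrt n], and [N * log l / (log log l) ^ 2] is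
    [O(w)], so that both running times are [2 ^ o(n)].

    The reduction is executable in time [2 ^ O(w)] because it is written in a
    first-order language of folds that all stop after a number of steps given
    by a clock: its running time is then polynomial in the clock, whatever the
    data. *)

(** * A language of clocked folds *)

Inductive fn :=
  | Id
  | Nl
  | Cn of fn & fn
  | Hd of fn
  | Tl of fn
  | Ite of fn & fn & fn
  | Cp of fn & fn
  | Fold of fn & fn & fn.

Fixpoint spine (t : tree) : seq tree :=
  if t is Cons a b then a :: spine b else [::].

Definition of_seq (l : seq tree) : tree := foldr Cons Nil l.

Lemma of_seqK : cancel of_seq spine.
Proof. by elim=> //= a l ->. Qed.

Lemma truth_spine (t : tree) : truth t = (0 < size (spine t)).
Proof. by case: t. Qed.

Lemma spine_tl (t : tree) : spine (tl t) = behead (spine t).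
Proof. by case: t. Qed.

Lemma spine_hd (t : tree) : hd t = head Nil (spine t).
Proof. by case: t. Qed.

(* Folds stop after [M] elements, where [M] is the length of a clock that is
   fixed in advance: this makes running times depend on [M] only. *)
Fixpoint run (M : nat) (p : fn) (x : tree) : tree :=
  match p with
  | Id => x
  | Nl => Nil
  | Cn p q => Cons (run M p x) (run M q x)
  | Hd p => hd (run M p x)
  | Tl p => tl (run M p x)
  | Ite p q r => if truth (run M p x) then run M q x else run M r x
  | Cp p q => run M p (run M q x)
  | Fold l a f =>
      foldl (fun acc e => run M f (Cons e (Cons acc x))) (run M a x)
            (take M (spine (run M l x)))
  end.

(** * Compilation to WHILE commands, with cost bounds *)

Definition skip (x : nat) := Assign x (Var x).

(** [sp.+1] holds the rest of the list, [sp.+2] the accumulator, [sp.+3] the rest of the clock,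
    [sp.+4] the argument and then the result of the body. The clock drives the loop: once the list
    is exhausted, the remaining passes do nothing. *)
Definition fold_step (sp : nat) (body : cmd) : cmd :=
  Seq (Assign sp.+3 (ETl (Var sp.+3)))
  (If (Var sp.+1)
    (Seq (Assign sp.+4 (ECons (EHd (Var sp.+1)) (ECons (Var sp.+2) (Var sp))))
    (Seq body
    (Seq (Assign sp.+2 (Var sp.+4))
         (Assign sp.+1 (ETl (Var sp.+1))))))
    (skip sp)).

(* Variable [sp] holds the argument and receives the result; larger variables
   are scratch space. *)
Fixpoint compile (clk : nat) (p : fn) (sp : nat) : cmd :=
  match p with
  | Id => skip sp
  | Nl => Assign sp ENil
  | Cn p q =>
      Seq (Assign sp.+1 (Var sp))
      (Seq (compile clk p sp.+1)
      (Seq (Assign sp.+2 (Var sp))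
      (Seq (compile clk q sp.+2)
           (Assign sp (ECons (Var sp.+1) (Var sp.+2))))))
  | Hd p => Seq (compile clk p sp) (Assign sp (EHd (Var sp)))
  | Tl p => Seq (compile clk p sp) (Assign sp (ETl (Var sp)))
  | Ite p q r =>
      Seq (Assign sp.+1 (Var sp))
      (Seq (compile clk p sp.+1)
           (If (Var sp.+1) (compile clk q sp) (compile clk r sp)))
  | Cp p q => Seq (compile clk q sp) (compile clk p sp)
  | Fold l a f =>
      Seq (Assign sp.+1 (Var sp))
      (Seq (compile clk l sp.+1)
      (Seq (Assign sp.+2 (Var sp))
      (Seq (compile clk a sp.+2)
      (Seq (Assign sp.+3 (Var clk))
      (Seq (While (Var sp.+3) (fold_step sp (compile clk f sp.+4)))
           (Assign sp (Var sp.+2)))))))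
  end.

(** A bound that ignores the data: a conditional is charged for both branches, a fold for [M] full
    passes. The 19 is the cost of a pass outside the body. *)
Fixpoint runtime (M : nat) (p : fn) : nat :=
  match p with
  | Id | Nl => 2
  | Cn p q => runtime M p + runtime M q + 8
  | Hd p | Tl p => runtime M p + 3
  | Ite p q r => runtime M p + runtime M q + runtime M r + 4
  | Cp p q => runtime M p + runtime M q
  | Fold l a f => runtime M l + runtime M a + M * (runtime M f + 19) + 10
  end.

(** The degree is the sum of the degrees of the subprograms, plus one for each fold. *)
Lemma runtime_poly (p : fn) : exists C d, forall M, runtime M p <= C * M.+1 ^ d.
Proof.
have E M d d' : d <= d' -> M.+1 ^ d <= M.+1 ^ d' by move=> ?; rewrite leq_pexp2l.
have P M d : 0 < M.+1 ^ d by rewrite expn_gt0.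
elim: p => [||p [C [d H]] q [C' [d' H']]|p [C [d H]]|p [C [d H]]
  |p [C [d H]] q [C' [d' H']] r [C'' [d'' H'']]
  |p [C [d H]] q [C' [d' H']]
  |p [C [d H]] q [C' [d' H']] r [C'' [d'' H'']]] /=.
- by exists 2, 0 => M.
- by exists 2, 0 => M.
- exists (C + C' + 8), (d + d') => M.
  have := H M; have := H' M; have := E M d (d + d'); have := E M d' (d + d').
  have := P M (d + d'); nia.
- by exists (C + 3), d => M; have := H M; have := P M d; nia.
- by exists (C + 3), d => M; have := H M; have := P M d; nia.
- exists (C + C' + C'' + 4), (d + d' + d'') => M.
  have := H M; have := H' M; have := H'' M; have := E M d (d + d' + d'').
  have := E M d' (d + d' + d''); have := E M d'' (d + d' + d'').
  have := P M (d + d' + d''); nia.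
- exists (C + C'), (d + d') => M.
  have := H M; have := H' M; have := E M d (d + d'); have := E M d' (d + d'); nia.
- exists (C + C' + C'' + 29), (d + d' + d'').+1 => M.
  have := H M; have := H' M; have := H'' M; have := E M d (d + d' + d'').
  have := E M d' (d + d' + d''); have := E M d'' (d + d' + d'').
  have := P M (d + d' + d''); rewrite expnS.
  move: (M.+1 ^ (d + d' + d'')) (M.+1 ^ d) (M.+1 ^ d') (M.+1 ^ d'') => X a a' a''.
  move=> X0 /(_ ltac:(lia)) h1 /(_ ltac:(lia)) h2 /(_ ltac:(lia)) h3.
  move: (runtime M p) (runtime M q) (runtime M r) => u v w h4 h5 h6.
  have ? : u <= C * X by nia.
  have ? : v <= C' * X by nia.
  have ? : w + 19 <= (C'' + 19) * X by nia.
  have ? : M * (w + 19) <= M * ((C'' + 19) * X) by rewrite leq_mul2l; lia.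
  nia.
Qed.

Lemma updE (s : store) x t : upd s x t x = t.
Proof. by rewrite /upd eqxx. Qed.

Lemma updN (s : store) x t y : y != x -> upd s x t y = s y.
Proof. by rewrite /upd => /negPf->. Qed.

Ltac upds := rewrite ?updE ?updN //; try by lia.

(** Branches and idle passes have different exact costs; upper bounds compose uniformly. *)
Definition exec_le s c s' T := exists2 U, exec s c s' U & U <= T.

Lemma exec_leW s c s' T T' : exec_le s c s' T -> T <= T' -> exec_le s c s' T'.
Proof. by case=> U ? ? ?; exists U => //; lia. Qed.

Lemma le_assign s x e : exec_le s (Assign x e) (upd s x (eval s e)) (ecost e).+1.
Proof. by exists (ecost e).+1 => //; constructor. Qed.

Lemma le_skip s x : exec_le s (skip x) s 2.
Proof.
suff {2}<- : upd s x (eval s (Var x)) = s by exact: le_assign.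
by apply: boolp.funext => y; rewrite /upd; case: eqP => // ->.
Qed.

Lemma le_seq s1 s s2 c d T U :
  exec_le s c s1 T -> exec_le s1 d s2 U -> exec_le s (Seq c d) s2 (T + U).
Proof.
by move=> [T' ? ?] [U' ? ?]; exists (T' + U'); [apply: XSeq; eauto|lia].
Qed.

Lemma le_if s s1 e c d T :
  (truth (eval s e) -> exec_le s c s1 T) ->
  (~~ truth (eval s e) -> exec_le s d s1 T) ->
  exec_le s (If e c d) s1 (ecost e + T).+1.
Proof.
case: (boolP (truth (eval s e))) => t Hc Hd.
  have [U ? ?] := Hc isT.
  by exists (ecost e + U).+1; [exact: XIfTrue|lia].
have [U ? ?] := Hd isT.
by exists (ecost e + U).+1; [exact: XIfFalse|lia].
Qed.

Lemma le_while_false s e c :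
  ~~ truth (eval s e) -> exec_le s (While e c) s (ecost e).+1.
Proof. by exists (ecost e).+1 => //; constructor. Qed.

Lemma le_while_true s1 s s2 e c T U :
  truth (eval s e) -> exec_le s c s1 T -> exec_le s1 (While e c) s2 U ->
  exec_le s (While e c) s2 (ecost e + T + U).+1.
Proof.
move=> ? [T' ? ?] [U' ? ?]; exists (ecost e + T' + U').+1; last by lia.
by apply: XWhileTrue; eauto.
Qed.

(** Preserving everything below [sp] protects the clock, as [clk < sp], and the values saved by the
    calling program, which runs a subprogram at a larger index whenever something must survive. *)
Definition computes (M clk : nat) (p : fn) := forall sp s,
  clk < sp -> size (spine (s clk)) = M ->
  exists s', [/\ exec_le s (compile clk p sp) s' (runtime M p),
                 s' sp = run M p (s sp) & forall y, y < sp -> s' y = s y].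

(** Induction on the remaining clock, for all stores and lists. The slot [sp] is among the preserved
    ones because every pass hands the argument to the body. *)
Lemma fold_loop M clk f sp s l : computes M clk f -> clk < sp ->
  size (spine (s clk)) = M -> spine (s sp.+1) = l ->
  let F acc e := run M f (Cons e (Cons acc (s sp))) in
  exists s', [/\ exec_le s (While (Var sp.+3) (fold_step sp (compile clk f sp.+4)))
                   s' (size (spine (s sp.+3)) * (runtime M f + 19) + 2),
    s' sp.+2 = foldl F (s sp.+2) (take (size (spine (s sp.+3))) l)
    & forall y, y < sp.+1 -> s' y = s y].
Proof.
move=> Cf ltsp.
move: {2}(size _) (erefl (size (spine (s sp.+3)))) => m.
elim: m s l => [|m IH] s l Em clkM El F.
  exists s; rewrite Em take0; split=> //.
  by apply: le_while_false; rewrite /= truth_spine Em.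
set s1 := upd s sp.+3 (tl (s sp.+3)).
have e1 : exec_le s (Assign sp.+3 (ETl (Var sp.+3))) s1 3 by exact: le_assign.
have Em1 : size (spine (s1 sp.+3)) = m by rewrite /s1 updE spine_tl size_behead Em.
have clk1 : size (spine (s1 clk)) = M by rewrite /s1 updN //; lia.
case: l El => [|e l] El.
  have ns : ~~ truth (s1 sp.+1) by rewrite truth_spine /s1 updN ?El //; lia.
  have [s' [ex Eout fr]] := IH s1 [::] Em1 clk1 ltac:(rewrite /s1 updN //; lia).
  exists s'; split; last by move=> y hy; rewrite fr // /s1 updN //; lia.
    rewrite Em; apply: exec_leW (le_while_true _ (le_seq e1 (le_if (T := 2) _ _)) ex) _.
    - by rewrite /= truth_spine Em.
    - by rewrite /= (negPf ns).
    - by move=> _; exact: le_skip.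
    - rewrite Em1 /=; lia.
  by rewrite Eout /= /s1 updN //; lia.
have ts : truth (s1 sp.+1) by rewrite truth_spine /s1 updN ?El //; lia.
set s2 := upd s1 sp.+4 (Cons (hd (s1 sp.+1)) (Cons (s1 sp.+2) (s1 sp))).
have e2 : exec_le s1 (Assign sp.+4 (ECons (EHd (Var sp.+1))
  (ECons (Var sp.+2) (Var sp)))) s2 7 by exact: le_assign.
have [||s3 [e3 v3 f3]] := Cf sp.+4 s2; first by lia.
  by rewrite /s2 updN //; lia.
set s4 := upd s3 sp.+2 (s3 sp.+4).
have e4 : exec_le s3 (Assign sp.+2 (Var sp.+4)) s4 2 by exact: le_assign.
set s5 := upd s4 sp.+1 (tl (s4 sp.+1)).
have e5 : exec_le s4 (Assign sp.+1 (ETl (Var sp.+1))) s5 3 by exact: le_assign.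
(* The body runs at [sp.+4], so once the clock is decremented, a pass changes only the list and the
   accumulator below that index. *)
have old y : y < sp.+4 -> y != sp.+1 -> y != sp.+2 -> s5 y = s1 y.
  by move=> *; rewrite /s5 /s4 !updN // f3 // /s2 updN //; lia.
have Em5 : size (spine (s5 sp.+3)) = m by rewrite old //; lia.
have clk5 : size (spine (s5 clk)) = M by rewrite old //; lia.
have El5 : spine (s5 sp.+1) = l.
  rewrite /s5 updE /s4 updN; last by lia.
  rewrite f3; last by lia.
  rewrite /s2 updN; last by lia.
  rewrite /s1 updN; last by lia.
  by rewrite spine_tl El.
have [s' [ex Eout fr]] := IH s5 l Em5 clk5 El5.
exists s'; split; last first.
  move=> y hy; rewrite fr // old //; try by lia.
  rewrite /s1 updN //; lia.
  rewrite Eout Em5 Em /=; congr foldl.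
    by apply: boolp.funext => acc; apply: boolp.funext => x;
       rewrite /F old ?/s1 ?updN //; lia.
  rewrite /s5 /s4 updN ?updE ?v3; last by lia.
  rewrite /s2 updE /F /s1 !updN; try by lia.
  by rewrite spine_hd El.
rewrite Em; apply: exec_leW (le_while_true _ (le_seq e1 (le_if (T := runtime M f + 12) _ _)) ex) _.
- by rewrite /= truth_spine Em.
- by move=> _; apply: exec_leW (le_seq e2 (le_seq e3 (le_seq e4 e5))) _; lia.
- by rewrite /= ts.
- rewrite Em5 /=; lia.
Qed.

Lemma compileP M clk p : computes M clk p.
Proof.
elim: p => [||p IHp q IHq|p IHp|p IHp|p IHp q IHq r IHr|p IHp q IHq|l IHl a IHa f IHf]
  sp s ltsp clkM /=.
- by exists s; split=> //; exact: le_skip.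
- exists (upd s sp Nil); split; [exact: le_assign|by upds|].
  by move=> y hy; upds.
- set s1 := upd s sp.+1 (s sp).
  have e1 : exec_le s (Assign sp.+1 (Var sp)) s1 2 by exact: le_assign.
  have [||s2 [e2 v2 f2]] := IHp sp.+1 s1; [by lia|by rewrite /s1; upds|].
  set s3 := upd s2 sp.+2 (s2 sp).
  have e3 : exec_le s2 (Assign sp.+2 (Var sp)) s3 2 by exact: le_assign.
  have [||s4 [e4 v4 f4]] := IHq sp.+2 s3; first by lia.
    by rewrite /s3 updN ?f2 /s1; upds.
  exists (upd s4 sp (Cons (s4 sp.+1) (s4 sp.+2))); split.
  + apply: exec_leW (le_seq e1 (le_seq e2 (le_seq e3 (le_seq e4 (le_assign _ _ _))))) _.
    rewrite /=; lia.
  + rewrite updE v4 f4 // /s3 updE updN ?v2 ?f2 //; try by lia.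
    by rewrite /s1 updE updN //; lia.
  + move=> y hy; rewrite updN ?f4 /s3 ?updN ?f2 /s1 ?updN //; lia.
- have [||s1 [e1 v1 f1]] := IHp sp s => //.
  exists (upd s1 sp (hd (s1 sp))); split.
  + exact: exec_leW (le_seq e1 (le_assign _ _ _)) _.
  + by rewrite updE v1.
  + by move=> y hy; rewrite updN ?f1 //; lia.
- have [||s1 [e1 v1 f1]] := IHp sp s => //.
  exists (upd s1 sp (tl (s1 sp))); split.
  + exact: exec_leW (le_seq e1 (le_assign _ _ _)) _.
  + by rewrite updE v1.
  + by move=> y hy; rewrite updN ?f1 //; lia.
- set s1 := upd s sp.+1 (s sp).
  have e1 : exec_le s (Assign sp.+1 (Var sp)) s1 2 by exact: le_assign.
  have [||s2 [e2 v2 f2]] := IHp sp.+1 s1; [by lia|by rewrite /s1; upds|].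
  have E y : y < sp.+1 -> s2 y = s y by move=> ?; rewrite f2 // /s1 updN //; lia.
  have clk2 : size (spine (s2 clk)) = M by rewrite E //; lia.
  rewrite (_ : run M p (s sp) = s2 sp.+1); last by rewrite v2 /s1 updE.
  case t: (truth (s2 sp.+1)).
    have [||s3 [e3 v3 f3]] := IHq sp s2 => //.
    exists s3; split; [|by rewrite v3 E|by move=> y hy; rewrite f3 // E //; lia].
    apply: exec_leW (le_seq e1 (le_seq e2 (le_if _ _))) _; [by move=> _; exact: e3|by rewrite /= t|].
    rewrite /=; lia.
  have [||s3 [e3 v3 f3]] := IHr sp s2 => //.
  exists s3; split; [|by rewrite v3 E|by move=> y hy; rewrite f3 // E //; lia].
  apply: exec_leW (le_seq e1 (le_seq e2 (le_if _ _))) _; [by rewrite /= t|by move=> _; exact: e3|].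
  rewrite /=; lia.
- have [||s1 [e1 v1 f1]] := IHq sp s => //.
  have [||s2 [e2 v2 f2]] := IHp sp s1 => //; first by rewrite f1.
  exists s2; split; [|by rewrite v2 v1|by move=> y hy; rewrite f2 ?f1].
  by apply: exec_leW (le_seq e1 e2) _; lia.
- set s1 := upd s sp.+1 (s sp).
  have e1 : exec_le s (Assign sp.+1 (Var sp)) s1 2 by exact: le_assign.
  have [||s2 [e2 v2 f2]] := IHl sp.+1 s1; [by lia|by rewrite /s1; upds|].
  set s3 := upd s2 sp.+2 (s2 sp).
  have e3 : exec_le s2 (Assign sp.+2 (Var sp)) s3 2 by exact: le_assign.
  have [||s4 [e4 v4 f4]] := IHa sp.+2 s3; first by lia.
    by rewrite /s3 updN ?f2 /s1; upds.
  set s5 := upd s4 sp.+3 (s4 clk).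
  have e5 : exec_le s4 (Assign sp.+3 (Var clk)) s5 2 by exact: le_assign.
  have old y : y <= sp -> s5 y = s y.
    by move=> hy; rewrite /s5 updN ?f4 /s3 ?updN ?f2 /s1 ?updN //; lia.
  have clk5 : size (spine (s5 clk)) = M by rewrite old //; lia.
  have [s6 [e6 v6 f6]] := fold_loop IHf ltsp clk5 (erefl _).
  have M3 : size (spine (s5 sp.+3)) = M.
    rewrite /s5 updE f4; last by lia.
    by rewrite /s3 updN ?f2 /s1 ?updN //; lia.
  rewrite M3 in e6 v6.
  exists (upd s6 sp (s6 sp.+2)); split.
  + apply: exec_leW (le_seq e1 (le_seq e2 (le_seq e3 (le_seq e4 (le_seq e5 (le_seq e6 (le_assign _ _ _))))))) _.
    rewrite /=; lia.
  + rewrite updE v6.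
    have -> : s5 sp.+1 = run M l (s sp).
      rewrite /s5 updN ?f4 /s3 ?updN ?v2 /s1 ?updE //; lia.
    have -> : s5 sp.+2 = run M a (s sp).
      rewrite /s5 updN ?v4 /s3 ?updE ?f2 /s1 ?updN //; lia.
    by rewrite old.
  + by move=> y hy; rewrite updN ?f6 ?old //; lia.
Qed.

(** * Building a clock of exponential length *)

Definition pow2 (w clk tmp : nat) : cmd :=
  Seq (Assign clk (ECons ENil ENil))
  (While (Var w)
    (Seq (Assign w (ETl (Var w)))
    (Seq (Assign tmp (Var clk))
         (While (Var tmp)
           (Seq (Assign tmp (ETl (Var tmp)))
                (Assign clk (ECons ENil (Var clk)))))))).

(** Each outer pass doubles the clock by adding one cell for each cell of a copy of it. The lengths
    form a geometric progression, so the total cost is linear in the final length. *)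
Lemma pow2P w s : exists s',
  [/\ exec_le s (pow2 w.+2 w w.+1) s' (20 * 2 ^ size (spine (s w.+2))),
      size (spine (s' w)) = 2 ^ size (spine (s w.+2))
    & forall y, y < w -> s' y = s y].
Proof.
have inner m (s0 : store) : size (spine (s0 w.+1)) = m -> exists s',
  [/\ exec_le s0 (While (Var w.+1) (Seq (Assign w.+1 (ETl (Var w.+1)))
                (Assign w (ECons ENil (Var w))))) s' (9 * m + 2),
   size (spine (s' w)) = size (spine (s0 w)) + m &
   forall y, y != w -> y != w.+1 -> s' y = s0 y].
  elim: m s0 => [|m IH] s0 Em.
    exists s0; split=> //; last by rewrite addn0.
    by apply: le_while_false; rewrite /= truth_spine Em.
  set s1 := upd s0 w.+1 (tl (s0 w.+1)); set s2 := upd s1 w (Cons Nil (s1 w)).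
  have [|s3 [e3 v3 f3]] := IH s2.
    by rewrite /s2 updN /s1 ?updE ?spine_tl ?size_behead ?Em //; lia.
  exists s3; split.
  - have e1 : exec_le s0 (Assign w.+1 (ETl (Var w.+1))) s1 3 by exact: le_assign.
    have e2 : exec_le s1 (Assign w (ECons ENil (Var w))) s2 4 by exact: le_assign.
    apply: exec_leW (le_while_true _ (le_seq e1 e2) e3) _.
      by rewrite /= truth_spine Em.
    rewrite /=; lia.
  - by rewrite v3 /s2 updE /s1 updN /=; lia.
  - by move=> y *; rewrite f3 // /s2 /s1 !updN.
have outer m (s0 : store) : size (spine (s0 w.+2)) = m -> exists s',
  [/\ exec_le s0 (While (Var w.+2)
    (Seq (Assign w.+2 (ETl (Var w.+2)))
    (Seq (Assign w.+1 (Var w))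
         (While (Var w.+1)
           (Seq (Assign w.+1 (ETl (Var w.+1)))
                (Assign w (ECons ENil (Var w)))))))) s'
       (9 * (size (spine (s0 w)) * (2 ^ m).-1) + 9 * m + 2),
   size (spine (s' w)) = size (spine (s0 w)) * 2 ^ m &
   forall y, y < w -> s' y = s0 y].
  elim: m s0 => [|m IH] s0 Em.
    exists s0; split=> //; last by rewrite muln1.
    apply: exec_leW (le_while_false _ _) _; first by rewrite /= truth_spine Em.
    rewrite /=; lia.
  set s1 := upd s0 w.+2 (tl (s0 w.+2)); set s2 := upd s1 w.+1 (s1 w).
  have [|s3 [e3 v3 f3]] := inner (size (spine (s0 w))) s2.
    by rewrite /s2 updE /s1 updN //; lia.
  have w3 : size (spine (s3 w)) = 2 * size (spine (s0 w)).
    by rewrite v3 /s2 /s1 !updN; lia.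
  have [|s4 [e4 v4 f4]] := IH s3.
    rewrite f3 /s2 ?updN /s1 ?updE ?spine_tl ?size_behead ?Em //; lia.
  exists s4; split.
  - have e1 : exec_le s0 (Assign w.+2 (ETl (Var w.+2))) s1 3 by exact: le_assign.
    have e2 : exec_le s1 (Assign w.+1 (Var w)) s2 2 by exact: le_assign.
    apply: exec_leW (le_while_true _ (le_seq e1 (le_seq e2 e3)) e4) _.
      by rewrite /= truth_spine Em.
    rewrite w3 /= expnS; have : 0 < 2 ^ m by rewrite expn_gt0.
    move: (2 ^ m) => X; case: X => // X _; nia.
  - by rewrite v4 w3 expnS; lia.
  - by move=> y hy; rewrite f4 ?f3 /s2 /s1 ?updN //; lia.
have [s' [e v f]] := outer _ (upd s w (Cons Nil Nil)) (erefl _).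
exists s'; split.
- have e1 : exec_le s (Assign w (ECons ENil ENil)) (upd s w (Cons Nil Nil)) 4.
    exact: le_assign.
  apply: exec_leW (le_seq e1 e) _.
  rewrite updE updN; last by lia.
  rewrite /=; move: (size _) => m.
  have := ltn_expl m (isT : 1 < 2); case: (2 ^ m) => // X; lia.
- rewrite v updE updN /=; lia.
- by move=> y hy; rewrite f // updN //; lia.
Qed.

(** * Dependence of a command on the variables it mentions *)

Fixpoint evars (e : expr) : nat :=
  match e with
  | Var x => x.+1
  | ENil => 0
  | ECons a b => maxn (evars a) (evars b)
  | EHd a | ETl a => evars a
  end.

Fixpoint cvars (c : cmd) : nat :=
  match c with
  | Assign x e => maxn x.+1 (evars e)
  | Seq c d => maxn (cvars c) (cvars d)
  | If e c d => maxn (evars e) (maxn (cvars c) (cvars d))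
  | While e c => maxn (evars e) (cvars c)
  end.

Lemma eval_agree m s s' e : evars e <= m -> (forall y, y < m -> s y = s' y) ->
  eval s e = eval s' e.
Proof.
move=> + E; elim: e => [x xm||a IHa b IHb|a IH h|a IH h] /=; last 2 first.
- by rewrite IH.
- by rewrite IH.
- exact: E.
- by [].
- by rewrite geq_max => /andP[/IHa-> /IHb->].
Qed.

(** Transfers a run of [A] from its initial store to the store left by the reduction, which differs
    from it only in variables that [A] does not mention. *)
Lemma exec_agree m s c t T : exec s c t T -> cvars c <= m -> forall s',
  (forall y, y < m -> s y = s' y) ->
  exists2 t', exec s' c t' T & forall y, y < m -> t y = t' y.
Proof.
elim=> {s c t T} /=.
- move=> s x e; rewrite geq_max => /andP[_ ve] s' E.
  exists (upd s' x (eval s' e)); first by constructor.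
  by move=> y hy; rewrite (eval_agree ve E) /upd; case: eqP => // _; rewrite E.
- move=> s s1 s2 c d T U _ IHc _ IHd; rewrite geq_max => /andP[vc vd] s' E.
  have [t1 e1 E1] := IHc vc s' E; have [t2 e2 E2] := IHd vd t1 E1.
  by exists t2 => //; apply: XSeq; eauto.
- move=> s s1 e c d T t _ IH; rewrite !geq_max => /and3P[ve vc _] s' E.
  have [t1 e1 E1] := IH vc s' E; exists t1 => //.
  by apply: XIfTrue => //; rewrite -(eval_agree ve E).
- move=> s s1 e c d T t _ IH; rewrite !geq_max => /and3P[ve _ vd] s' E.
  have [t1 e1 E1] := IH vd s' E; exists t1 => //.
  by apply: XIfFalse => //; rewrite -(eval_agree ve E).
- move=> s e c t; rewrite geq_max => /andP[ve _] s' E; exists s' => //.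
  by apply: XWhileFalse => //; rewrite -(eval_agree ve E).
- move=> s s1 s2 e c T U t _ IHc _ IHw v s' E; have := v; rewrite geq_max.
  case/andP=> ve vc; have [t1 e1 E1] := IHc vc s' E; have [t2 e2 E2] := IHw v t1 E1.
  exists t2 => //; apply: XWhileTrue; eauto.
  by rewrite -(eval_agree ve E).
Qed.

(** * Numbers and bit strings as trees *)

Definition un (n : nat) : tree := of_seq (nseq n Nil).

Lemma spine_un n : spine (un n) = nseq n Nil.
Proof. exact: of_seqK. Qed.

Lemma truthE b : truth (tree_of_bool b) = b.
Proof. by case: b. Qed.

Lemma spine_bits (s : seq bool) : spine (tree_of_bits s) = map tree_of_bool s.
Proof. by elim: s => //= b s ->. Qed.

Lemma tree_of_bitsE (s : seq bool) : tree_of_bits s = of_seq (map tree_of_bool s).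
Proof. by elim: s => //= b s ->. Qed.

(* Most significant bit first, unlike [bits]. *)
Definition bval (s : seq bool) : nat := foldl (fun m (b : bool) => b + m.*2) 0 s.

(* Programs take the list of their arguments; the body of a fold finds the
   current element and the accumulator in front of them. *)
Definition EVar (i : nat) : fn := Hd (iter i Tl Id).
Definition call (p : fn) (l : seq fn) : fn := Cp p (foldr Cn Nl l).
Notation "'$' i" := (EVar i) (at level 1, i at level 0, format "'$' i").
Notation "p @@ l" := (call p l) (at level 20).

Definition f_true : fn := Cn Nl Nl.
Definition f_not (p : fn) : fn := Ite p Nl f_true.

Definition f_drop : fn := Fold $0 $1 (Tl $1).
Definition f_add : fn := Fold $0 $1 (Cn Nl $1).
Definition f_mul : fn := Fold $0 Nl (f_add @@ [:: $3; $1]).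
Definition f_rev : fn := Fold $0 Nl (Cn $0 $1).
(** The accumulator is a descending list whose head is the next counter; [f_true] doubles as the
    list containing only 0. The outer [Tl] removes [n] itself, and the result is descending. *)
Definition f_iota : fn := Tl (Fold $0 f_true (Cn (Cn Nl (Hd $1)) $1)).
(** In unary, dropping [p] cells from [q] leaves something exactly when [p < q]; only [p] has to fit
    in the clock. *)
Definition f_lt (p q : fn) : fn := f_drop @@ [:: p; q].
Definition f_eq : fn := Ite (f_lt $0 $1) Nl (f_not (f_lt $1 $0)).
(** The accumulator pairs the unread bits with the value read so far, which is doubled by adding it
    to itself. The length of the first argument is the number of bits to read. *)
Definition f_val : fn :=
  Tl (Fold $0 (Cn $1 Nl)
    (Cn (Tl (Hd $1))
        (Ite (Hd (Hd $1)) (Cn Nl (f_add @@ [:: Tl $1; Tl $1]))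
                          (f_add @@ [:: Tl $1; Tl $1])))).


Notation "[@ ]" := Nil (at level 0).
Notation "[@ x ; .. ; y ]" := (Cons x .. (Cons y Nil) ..) (at level 0).

Section Library.
Variable M : nat.
Implicit Types (a x y : tree) (l : seq tree).

Lemma take_spine a : size (spine a) <= M -> take M (spine a) = spine a.
Proof. exact: take_oversize. Qed.

Lemma run_drop a l m : size (spine a) = m -> m <= M ->
  run M f_drop [@ a; of_seq l] = of_seq (drop m l).
Proof.
move=> Ea leM; rewrite /= take_spine ?Ea //.
elim: (spine a) m l Ea {leM} => [|e r IH] m l <- /=; first by rewrite drop0.
by case: l => [|z l] /=; [rewrite (IH _ [::] erefl)|rewrite (IH _ _ erefl)].
Qed.

Lemma run_lt m n : m <= M -> truth (run M f_drop [@ un m; un n]) = (m < n).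
Proof.
move=> leM; rewrite (@run_drop _ _ m) ?spine_un ?size_nseq //.
by rewrite truth_spine of_seqK size_drop size_nseq subn_gt0.
Qed.

Lemma run_eq m n : m <= M -> n <= M ->
  run M f_eq [@ un m; un n] = tree_of_bool (m == n).
Proof. by move=> *; rewrite /= !run_lt //; case: ltngtP. Qed.

Lemma run_sub m n : m <= M -> run M f_drop [@ un m; un n] = un (n - m).
Proof.
move=> leM; rewrite (@run_drop _ _ m) ?spine_un ?size_nseq //.
by rewrite drop_nseq.
Qed.
Opaque f_drop f_eq.

Lemma run_add m n : m <= M -> run M f_add [@ un m; un n] = un (m + n).
Proof.
move=> leM; rewrite /= take_spine !spine_un ?size_nseq //.
by elim: m n {leM} => //= m IH n; rewrite -[Cons _ _]/(un n.+1) IH addnS.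
Qed.
Opaque f_add.

Lemma run_mul m n : m <= M -> n <= M -> run M f_mul [@ un m; un n] = un (m * n).
Proof.
move=> lem len; rewrite /= take_spine !spine_un ?size_nseq //.
suff H j : foldl (fun acc _ => run M f_add [@ un n; acc]) (un j) (nseq m Nil) =
  un (j + m * n) by exact: (H 0).
elim: m j {lem} => [|m IH] j /=; first by rewrite addn0.
by rewrite run_add // IH; congr un; lia.
Qed.
Opaque f_mul.

Lemma run_rev l : size l <= M -> run M f_rev [@ of_seq l] = of_seq (rev l).
Proof.
move=> leM; rewrite /= of_seqK take_oversize //.
suff H r : foldl (fun acc e => Cons e acc) (of_seq r) l = of_seq (rev l ++ r).
  by rewrite (H [::]) cats0.
by elim: l r {leM} => //= z l IH r; rewrite (IH (z :: r)) rev_cons cat_rcons.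
Qed.
Opaque f_rev.

Lemma rev_iotaS n : rev (iota 0 n.+1) = n :: rev (iota 0 n).
Proof. by rewrite -addn1 iotaD rev_cat. Qed.

Lemma run_iota n : n <= M ->
  run M f_iota [@ un n] = of_seq (map un (rev (iota 0 n))).
Proof.
move=> leM; rewrite /= take_spine !spine_un ?size_nseq //.
suff -> : foldl (fun acc _ => Cons (Cons Nil (hd acc)) acc) (Cons Nil Nil)
  (nseq n Nil) = of_seq (map un (rev (iota 0 n.+1))).
  by rewrite rev_iotaS.
have -> : nseq n Nil = rev (nseq n Nil) by rewrite rev_nseq.
rewrite foldl_rev; elim: n {leM} => // n IH.
by rewrite [nseq _ _]/= [foldr _ _ _]/= IH !rev_iotaS.
Qed.
Opaque f_iota.

Lemma bval_rcons s b : bval (rcons s b) = b + (bval s).*2.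
Proof. by rewrite /bval foldl_rcons. Qed.

Lemma bval_lt s : bval s < 2 ^ size s.
Proof.
elim/last_ind: s => // s b IH.
by rewrite bval_rcons size_rcons expnS; case: b; lia.
Qed.

Lemma run_val a m s : size (spine a) = m -> m <= size s -> 2 ^ m <= M ->
  run M f_val [@ a; tree_of_bits s] = un (bval (take m s)).
Proof.
move=> Ea les leM.
have mM : m <= M by apply: leq_trans leM; apply/ltnW/ltn_expl.
rewrite /= take_spine ?Ea //.
set F := fun acc e => _.
suff H : foldl F (Cons (tree_of_bits s) Nil) (spine a) =
  Cons (tree_of_bits (drop m s)) (un (bval (take m s))) by rewrite H.
elim/last_ind: (spine a) m Ea les leM mM => [|r e IH] m.
  by move=> <- *; rewrite take0 drop0.
rewrite size_rcons => <- les leM mM; rewrite foldl_rcons (IH (size r)) //; try by lia.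
  2: by apply: leq_trans leM; rewrite leq_exp2l.
have lt2 := bval_lt (take (size r) s); rewrite size_takel in lt2; last by lia.
rewrite (take_nth false) // bval_rcons.
rewrite /F /= (drop_nth false les) /= run_add -?addnn; last first.
  by apply: leq_trans leM; rewrite expnS; lia.
by congr Cons; case: nth.
Qed.
Opaque f_val.

End Library.

Opaque f_drop f_eq f_add f_mul f_rev f_iota f_val.
(** * The forbidden distances *)

Definition chunk (b : nat) (s : seq bool) (c : nat) : nat :=
  bval (take b (drop (c * b) s)).

(** The edge lists supplied here hold each edge once, smaller end first, hence the test of both
    orders. *)
Definition near_eq (E : seq (nat * nat)) (x y : nat) : bool :=
  (x == y) || has (fun e => ((e.1 == x) && (e.2 == y)) || ((e.1 == y) && (e.2 == x))) E.

(* The string [s] is [c_j ++ a_i]: its first [q] chunks are positions in the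
   list of vertices, the other ones are entries of that list. *)
Definition link_at n k b q E (i j : nat) (s : seq bool) (t : nat) : bool :=
  (j * q + t < n) ==>
  ((chunk b s t < k) &&
   ((i * q <= chunk b s t < i * q + q) ==>
    near_eq E (chunk b s (chunk b s t - i * q + q)) (j * q + t))).

Definition linked n k b q E (i j : nat) (s : seq bool) : bool :=
  all (link_at n k b q E i j s) (iota 0 q).

(* Vertex [x < K] carries [a_x], vertex [K + j] carries [c_j], and [K + K] and
   [(K + K).+1] get the extreme colors; [s] is the distance in binary. *)
Definition forb n k b q K E (x y : nat) (s : seq bool) : bool :=
  if x < K then
    if y < K then false
    else if y < K + K then ~~ linked n k b q E x (y - K) s
    else if y < (K + K).+1 then 0 < bval (take (q * b) s)
    else false
  else if x < K + K then
    if y < K + K then false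
    else if y < (K + K).+1 then ~~ all id (drop (q * b) s)
    else false
  else ~~ all id s.

Definition edge_tree (E : seq (nat * nat)) : tree :=
  of_seq (map (fun e => Cons (un e.1) (un e.2)) E).

Definition data_tree n k b q K E : tree :=
  [@ un b; un n; un k; edge_tree E; un q; un K; un (q * b); un (K + K)].

Definition fld (i : nat) (p : fn) : fn := Hd (iter i Tl p).
Definition fld_b := fld 0.
Definition fld_n := fld 1.
Definition fld_k := fld 2.
Definition fld_E := fld 3.
Definition fld_q := fld 4.
Definition fld_K := fld 5.
Definition fld_w := fld 6.
Definition fld_KK := fld 7.

Definition f_chunk : fn :=
  f_val @@ [:: $0; f_drop @@ [:: f_mul @@ [:: $1; $0]; $2]].
Definition f_near : fn :=
  Ite (f_eq @@ [:: $1; $2]) f_true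
    (Fold $0 Nl (Ite $1 f_true
       (Ite (Ite (f_eq @@ [:: (Hd $0); $3]) (f_eq @@ [:: (Tl $0); $4]) Nl) f_true
            (Ite (f_eq @@ [:: (Hd $0); $4]) (f_eq @@ [:: (Tl $0); $3]) Nl)))).
(* Arguments: the data, [i], [j], [s], [t], then [i * q], [j * q + t] and the
   [t]-th chunk of [s]. *)
Definition f_link_aux : fn :=
  Ite (f_lt $6 (fld_n $0))
    (Ite (f_lt $7 (fld_k $0))
       (Ite (f_lt $7 $5) f_true
          (Ite (f_lt $7 (f_add @@ [:: $5; fld_q $0]))
             (f_near @@ [:: fld_E $0;
                f_chunk @@ [:: fld_b $0;
                   f_add @@ [:: f_drop @@ [:: $5; $7]; fld_q $0]; $3];
                $6])
             f_true))
       Nl)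
    f_true.
Definition f_link_at : fn :=
  f_link_aux @@ [:: $0; $1; $2; $3; $4; f_mul @@ [:: $1; fld_q $0];
     f_add @@ [:: f_mul @@ [:: $2; fld_q $0]; $4];
     f_chunk @@ [:: fld_b $0; $4; $3]].
Definition f_linked : fn :=
  Fold (f_iota @@ [:: fld_q $0]) f_true
    (Ite $1 (f_link_at @@ [:: $2; $3; $4; $5; $0]) Nl).
Definition f_all : fn := Fold $0 f_true (Ite $1 (Ite $0 f_true Nl) Nl).
Definition f_forb : fn :=
  Ite (f_lt $1 (fld_K $0))
    (Ite (f_lt $2 (fld_K $0)) Nl
    (Ite (f_lt $2 (fld_KK $0))
       (f_not (f_linked @@ [:: $0; $1; f_drop @@ [:: fld_K $0; $2]; $3]))
    (Ite (f_lt $2 (Cn Nl (fld_KK $0))) (f_val @@ [:: fld_w $0; $3]) Nl)))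
    (Ite (f_lt $1 (fld_KK $0))
       (Ite (f_lt $2 (fld_KK $0)) Nl
       (Ite (f_lt $2 (Cn Nl (fld_KK $0)))
          (f_not (f_all @@ [:: f_drop @@ [:: fld_w $0; $3]])) Nl))
       (f_not (f_all @@ [:: $3]))).

Lemma run_chunk M b s c : c * b + b <= size s -> c <= M -> b <= M -> c * b <= M ->
  2 ^ b <= M ->
  run M f_chunk [@ un b; un c; tree_of_bits s] = un (chunk b s c).
Proof.
move=> *; rewrite /= run_mul // tree_of_bitsE.
rewrite (@run_drop _ _ _ (c * b)) ?spine_un ?size_nseq // -map_drop -tree_of_bitsE.
by rewrite (@run_val _ _ b) // ?spine_un ?size_nseq // size_drop; lia.
Qed.

Lemma foldl_or (T : Type) (f : tree -> T -> tree) (p : T -> bool) l x :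
  (forall a y, truth (f a y) = truth a || p y) ->
  truth (foldl f x l) = truth x || has p l.
Proof.
move=> H; elim: l x => [|y l IH] x /=; first by rewrite orbF.
by rewrite IH H orbA.
Qed.

Lemma foldl_mapE (A B T : Type) (f : T -> B -> T) (g : A -> B) l x :
  foldl f x (map g l) = foldl (fun a y => f a (g y)) x l.
Proof. by elim: l x => //= y l IH x. Qed.

Lemma eq_foldl_in (A : eqType) (T : Type) (f g : T -> A -> T) l x :
  (forall a y, y \in l -> f a y = g a y) -> foldl f x l = foldl g x l.
Proof.
elim: l x => //= y l IH x H; rewrite H ?inE ?eqxx // IH //.
by move=> a z zl; rewrite H // inE zl orbT.
Qed.

Lemma run_near M E x y : size E <= M -> x <= M -> y <= M ->
  (forall e, e \in E -> e.1 <= M /\ e.2 <= M) ->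
  truth (run M f_near [@ edge_tree E; un x; un y]) = near_eq E x y.
Proof.
move=> sE xM yM EM; rewrite /= run_eq // truthE /near_eq; case: eqP => //= _.
rewrite of_seqK take_oversize ?size_map // foldl_mapE.
set F := fun _ _ => _; set p := fun _ => _.
rewrite (@eq_foldl_in _ _ F (fun a e => if truth a then Cons Nil Nil else tree_of_bool (p e))).
  rewrite (foldl_or (p := p)) // => a z; rewrite -[in RHS](truthE (p z)).
  by case: (truth a).
move=> a e /EM[e1 e2]; rewrite /F /p /= !run_eq // !truthE.
by case: (truth a) => //; case: (e.1 == x); case: (e.1 == y);
   case: (e.2 == y); case: (e.2 == x).
Qed.
Opaque f_near f_chunk.

Section Predicate.
Variables (M n k b q K : nat) (E : seq (nat * nat)).
Hypotheses (leb : 2 ^ b <= M) (lenM : n <= M) (lenE : size E <= M).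
Hypotheses (lenq : K * q + q <= M) (lenb : q * b + q * b <= M) (lenK : K + K < M).
Hypothesis boundE : forall e, e \in E -> e.1 <= M /\ e.2 <= M.
Hypothesis lew : 2 ^ (q * b) <= M.
Hypotheses (q_gt0 : 0 < q) (b_gt0 : 0 < b).

Let D := data_tree n k b q K E.

Lemma chunk_lt s c : c * b + b <= size s -> chunk b s c < 2 ^ b.
Proof.
move=> h; have := bval_lt (take b (drop (c * b) s)).
by rewrite size_takel // size_drop; lia.
Qed.

Lemma run_link_at i j s t : size s = q * b + q * b -> i < K -> j < K -> t < q ->
  truth (run M f_link_at [@ D; un i; un j; tree_of_bits s; un t]) =
  link_at n k b q E i j s t.
Proof.
move=> ss iK jK tq.
have bM : b <= M by have := ltn_expl b (isT : 1 < 2); lia.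
have jq : j * q + q <= K * q by rewrite -mulSnr leq_mul2r; lia.
have iq : i * q + q <= K * q by rewrite -mulSnr leq_mul2r; lia.
have cb c : c < q + q -> c * b + b <= q * b + q * b.
  by move=> ?; rewrite -mulSnr -mulnDl leq_mul2r; lia.
have tb := cb t ltac:(lia).
have ct : chunk b s t < 2 ^ b by apply: chunk_lt; lia.
have qM : q <= M by lia.
have KqM : K <= M by lia.
rewrite /= !run_mul //; try by lia.
rewrite run_add; last by lia.
rewrite run_chunk //; try by lia.
rewrite !run_lt ?run_add; try by lia.
rewrite /link_at; case: ltnP => //= _; case: (ltnP _ k) => //= _.
case: ltnP => //= h1; rewrite run_lt; last by lia.
case: ltnP => //= h2; rewrite run_sub; last by lia.
rewrite run_add; last by lia.
(* The position lies in block [i], so its offset is below [q], and this chunk is in the second half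
   of [s]. *)
have hc := cb (chunk b s t - i * q + q) ltac:(lia).
rewrite run_chunk //; try by lia.
rewrite run_near //; try by lia.
have : chunk b s (chunk b s t - i * q + q) < 2 ^ b by apply: chunk_lt; lia.
by lia.
Qed.
Opaque f_link_at.

Lemma foldl_and (T : Type) (f : T -> tree) l x :
  truth (foldl (fun a y => if truth a then f y else Nil) x l) =
  truth x && all (fun y => truth (f y)) l.
Proof.
elim: l x => [|y l IH] x /=; first by rewrite andbT.
by rewrite IH; case: (truth x).
Qed.

Lemma run_linked i j s : size s = q * b + q * b -> i < K -> j < K ->
  truth (run M f_linked [@ D; un i; un j; tree_of_bits s]) = linked n k b q E i j s.
Proof.
move=> ss iK jK; rewrite /= run_iota; last by lia.
rewrite of_seqK take_oversize ?size_map ?size_rev ?size_iota; last by lia.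
rewrite foldl_mapE foldl_and all_rev /=; apply: eq_in_all => t.
by rewrite mem_iota => /andP[_ tq]; rewrite run_link_at.
Qed.
Opaque f_linked.

Lemma run_all s : size s <= M -> truth (run M f_all [@ tree_of_bits s]) = all id s.
Proof.
move=> ss; rewrite /= spine_bits take_oversize ?size_map // foldl_mapE.
set F := fun _ _ => _.
rewrite (_ : F = fun a c => if truth a then tree_of_bool c else Nil).
  by rewrite foldl_and; apply: eq_all; case.
by apply: boolp.funext => a; apply: boolp.funext => -[].
Qed.
Opaque f_all.

Lemma run_forb x y s : size s = q * b + q * b -> x < y -> y < (K + K).+2 ->
  truth (run M f_forb [@ D; un x; un y; tree_of_bits s]) =
  forb n k b q K E x y s.
Proof.
move=> ss xy yK.
have bM : b <= M by have := ltn_expl b (isT : 1 < 2); lia.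
have qM : q <= M by lia.
have val_w : truth (run M f_val [@ un (q * b); tree_of_bits s]) =
    (0 < bval (take (q * b) s)).
  rewrite (@run_val _ _ (q * b)) ?spine_un ?size_nseq //; last by lia.
  by rewrite truth_spine spine_un size_nseq.
have all_w : truth (run M f_all [@ run M f_drop [@ un (q * b); tree_of_bits s]]) =
    all id (drop (q * b) s).
  rewrite tree_of_bitsE (@run_drop _ _ _ (q * b)) ?spine_un ?size_nseq //; last by lia.
  by rewrite -map_drop -tree_of_bitsE run_all // size_drop; lia.
have notE (t : tree) : truth (if truth t then Nil else Cons Nil Nil) = ~~ truth t.
  by case: (truth t).
rewrite /= !run_lt; try by lia.
rewrite -[Cons [@ ] (un (K + K))]/(un (K + K).+1).
rewrite /forb; case: ltnP => xK.
  case: ltnP => //= yK1; case: ltnP => yK2.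
    by rewrite notE run_sub ?run_linked //; lia.
  rewrite run_lt; last by lia.
  by case: ltnP.
case: ltnP => xKK; last by rewrite notE run_all //; lia.
case: ltnP => //= yKK; rewrite run_lt; last by lia.
by case: ltnP => //= _; rewrite notE all_w.
Qed.

End Predicate.
Opaque f_forb.


(** * Writing the instance *)

Fixpoint all_bits (m : nat) : seq (seq bool) :=
  if m is m'.+1 then map (cons false) (all_bits m') ++ map (cons true) (all_bits m')
  else [:: [::]].

Lemma bval_cons b s : bval (b :: s) = b * 2 ^ size s + bval s.
Proof.
elim/last_ind: s => [|s c IH]; first by case: b.
by rewrite -rcons_cons !bval_rcons IH size_rcons expnS; lia.
Qed.

Lemma bval_cat s t : bval (s ++ t) = bval s * 2 ^ size t + bval t.
Proof.
by elim: s => //= b s IH; rewrite !bval_cons IH size_cat expnD; lia.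
Qed.

Lemma size_all_bits m s : s \in all_bits m -> size s = m.
Proof.
elim: m s => [|m IH] s /=; first by rewrite inE => /eqP->.
by rewrite mem_cat => /orP[] /mapP[t /IH <- ->].
Qed.

(** The strings come in increasing order of value. One list thus enumerates the distances in sorted
    order and also serves as a table of binary expansions. *)
Lemma bval_all_bits m : map bval (all_bits m) = iota 0 (2 ^ m).
Proof.
elim: m => //= m IH; rewrite map_cat -!map_comp.
rewrite (_ : map (_ \o cons true) _ = map (addn (2 ^ m)) (map bval (all_bits m))).
  rewrite (_ : map (bval \o cons false) _ = map bval (all_bits m)); last first.
    by apply/eq_in_map => s _ /=; rewrite bval_cons.
  by rewrite IH -iotaDl addn0 expnS mul2n -addnn iotaD.
rewrite -map_comp; apply/eq_in_map => s /size_all_bits ss /=.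
by rewrite bval_cons ss mul1n.
Qed.

Lemma size_all_bitsE m : size (all_bits m) = 2 ^ m.
Proof. by rewrite -(size_map bval) bval_all_bits size_iota. Qed.

Definition app (u : seq bool) (t : tree) : tree :=
  foldr (fun b => Cons (tree_of_bool b)) t u.

Lemma app_cat u v t : app (u ++ v) t = app u (app v t).
Proof. exact: foldr_cat. Qed.

Definition f_extend : fn :=
  Fold $0 (Fold $0 Nl (Cn (Cn Nl $0) $1)) (Cn (Cn f_true $0) $1).
(** Pushing on the front reverses a list: the accumulator is the reversed list of strings, and it is
    turned around before each extension. [f_true] is the list containing only the empty string. *)
Definition f_all_bits : fn :=
  Fold $0 f_true (f_extend @@ [:: f_rev @@ [:: $1]]).
(** The head of the accumulator records whether a [true] has been met, so that leading zeros are
    skipped. Pushing bits read from the most significant one gives the order of [bits]. If the flag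
    is never raised, the code of the single digit of 0 is written. *)
Definition f_code : fn :=
  Cp (Ite (Hd Id) (Tl Id) (Cn f_true (Cn Nl (Tl Id))))
     (Fold $0 (Cn Nl (Cn Nl $1))
       (Ite (Ite $0 f_true (Hd $1))
            (Cn f_true (Cn f_true (Cn $0 (Tl $1)))) $1)).
(* Codes are produced from right to left, so that no concatenation is needed. *)
Definition f_gen_aux : fn :=
  f_code @@ [:: Hd (f_drop @@ [:: $2; f_rev @@ [:: $1]]);
  f_code @@ [:: Cn f_true (f_add @@ [:: fld_w $0; fld_w $0]);
  Fold (f_iota @@ [:: $2]) Nl
    (Fold (f_iota @@ [:: $4]) $1
      (Ite (f_lt $2 $0)
         (Cn f_true
           (Fold $5 (Cn Nl $1)
             (Ite (f_forb @@ [:: $6; $4; $2; $0])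
                (Cn f_true (f_code @@ [:: $0; $1])) $1)))
         $1))]].
Definition f_gen : fn :=
  f_gen_aux @@ [:: $0; f_all_bits @@ [:: f_add @@ [:: fld_w $0; fld_w $0]];
                   Cn Nl (Cn Nl (fld_KK $0))].

Definition bits_tree (l : seq (seq bool)) : tree := of_seq (map tree_of_bits l).

Lemma run_all_bits M m : m <= M -> 2 ^ m <= M ->
  run M f_all_bits [@ un m] = bits_tree (rev (all_bits m)).
Proof.
move=> mM mM2; rewrite /= take_spine !spine_un ?size_nseq //.
elim: m mM mM2 => // m IH mM mM2.
rewrite -[m.+1]addn1 nseqD foldl_cat IH; first last.
- by apply: leq_trans mM2; rewrite leq_exp2l.
- by lia.
have sM : size (all_bits m) <= M.
  by rewrite size_all_bitsE; apply: leq_trans mM2; rewrite leq_exp2l.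
rewrite /= /bits_tree run_rev ?size_map ?size_rev // map_rev revK.
rewrite of_seqK take_oversize ?size_map // addn1 /= rev_cat map_cat.
have push c r l : foldl (fun acc e => Cons (Cons (tree_of_bool c) e) acc) (of_seq r)
   (map tree_of_bits l) = of_seq (map tree_of_bits (rev (map (cons c) l)) ++ r).
  elim: l r => [|s l IHl] r //; rewrite [LHS]/= (IHl (tree_of_bits (c :: s) :: r)).
  by rewrite [map (cons c) _]/= rev_cons map_rcons cat_rcons.
have := push false [::] (all_bits m); rewrite cats0 => push0.
transitivity (foldl (fun acc e => Cons (Cons (tree_of_bool true) e) acc)
  (of_seq (map tree_of_bits (rev (map (cons false) (all_bits m)))))
  (map tree_of_bits (all_bits m))); last exact: push.
by congr foldl; exact: push0.
Qed.
Opaque f_all_bits.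

(** Matches the Horner step of [bval] with the expansion that starts at the least significant
    bit. *)
Lemma bits_double (c : bool) n : 0 < n -> bits (c + n.*2) = c :: bits n.
Proof.
move=> n0; rewrite /bits trunc_log2S; last by case: c; lia.
have -> : (c + n.*2)./2 = n by rewrite -[RHS](half_bit_double n c).
rewrite -[iota 0 _.+2]/(0 :: iota (1 + 0) _.+1) map_cons iotaDl -map_comp.
congr cons; first by rewrite divn1 oddD odd_double addbF; case: c.
apply: eq_map => i /=; rewrite add1n expnS divnMA; congr odd; congr divn.
by rewrite -[RHS](half_bit_double n c) -divn2.
Qed.



Opaque bits.
Definition bit_code (s : seq bool) : seq bool := flatten [seq [:: true; b] | b <- s].

Lemma run_code M s t : size s <= M ->
  run M f_code [@ tree_of_bits s; t] = app (code_nat (bval s)) t.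
Proof.
move=> sM; rewrite /= spine_bits take_oversize ?size_map // foldl_mapE.
set F := fun _ _ => _; set x := foldl _ _ _.
suff -> : x = Cons (tree_of_bool (0 < bval s))
    (if 0 < bval s then app (bit_code (bits (bval s))) (Cons Nil t) else Cons Nil t).
  rewrite /= truthE /code_nat /code_list app_cat.
  by case: (posnP (bval s)) => // ->.
rewrite {}/x; elim/last_ind: s {sM} => // s c IH.
rewrite foldl_rcons IH /F /= !truthE bval_rcons.
case: (posnP (bval s)) => [->|v0]; first by case: c.
rewrite addn_gt0 double_gt0 v0 orbT bits_double //=.
by case: c.
Qed.
Opaque f_code.

(** Prepending while going through the reversed list yields the concatenation in the original order;
    this is why descending lists suit the generator. *)
Lemma foldl_app (A : Type) (g : A -> seq bool) l t :
  foldl (fun acc e => app (g e) acc) t (rev l) = app (flatten (map g l)) t.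
Proof. by rewrite foldl_rev; elim: l => //= e l ->; rewrite app_cat. Qed.

Section Generate.
Variables (M n k b q K : nat) (E : seq (nat * nat)).
Hypotheses (leb : 2 ^ b <= M) (lenM : n <= M) (lenE : size E <= M).
Hypotheses (lenq : K * q + q <= M) (lenb : q * b + q * b <= M) (lenK : (K + K).+2 <= M).
Hypothesis boundE : forall e, e \in E -> e.1 <= M /\ e.2 <= M.
Hypothesis lew : 2 ^ (q * b + q * b) <= M.
Hypotheses (q_gt0 : 0 < q) (b_gt0 : 0 < b).
Hypothesis KK_lt : (K + K).+2 < 2 ^ (q * b + q * b).

Let w2 := q * b + q * b.
Let N := (K + K).+2.

(** Empty unless [x < y], so that a plain double loop enumerates the unordered pairs. The leading
    [true] announces an edge, as every pair is one. *)
Definition pair_code (x y : nat) : seq bool :=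
  if x < y then
    true :: flatten [seq true :: code_nat (bval s)
                    | s <- all_bits w2 & forb n k b q K E x y s] ++ [:: false]
  else [::].

Definition gen_code : seq bool :=
  code_nat N ++ code_nat (2 ^ w2) ++
  flatten [seq flatten [seq pair_code x y | y <- iota 0 N] | x <- iota 0 N].

Lemma run_gen : run M f_gen [@ data_tree n k b q K E] = tree_of_bits gen_code.
Proof.
rewrite /= run_add; last by lia.
rewrite -[Cons [@ ] (Cons [@ ] (un (K + K)))]/(un N).
rewrite run_all_bits // run_iota //.
rewrite /bits_tree map_rev run_rev; last by rewrite size_rev size_map size_all_bitsE.
rewrite revK.
rewrite (@run_drop _ _ _ N) ?spine_un ?size_nseq //.
have iotaE : take M (spine (of_seq (map un (rev (iota 0 N))))) = map un (rev (iota 0 N)).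
  by rewrite of_seqK take_oversize ?size_map ?size_rev ?size_iota.
rewrite iotaE foldl_mapE.
set u := foldl _ _ _.
have -> : u = app (flatten [seq flatten [seq pair_code x y | y <- iota 0 N] | x <- iota 0 N]) Nil.
  rewrite -foldl_app {}/u; apply: eq_foldl_in => t x.
  rewrite mem_rev mem_iota => /andP[_ xN].
  rewrite foldl_mapE -foldl_app; apply: eq_foldl_in => t' y.
  rewrite mem_rev mem_iota => /andP[_ yN].
  rewrite run_lt /pair_code; last by lia.
  case: ltnP => // xy.
  rewrite of_seqK take_oversize ?size_rev ?size_map ?size_all_bitsE //.
  rewrite -map_rev foldl_mapE /= app_cat; congr Cons.
  rewrite -[Cons [@ ] t']/(app [:: false] t').
  rewrite (_ : flatten _ = flatten [seq if forb n k b q K E x y s then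
     true :: code_nat (bval s) else [::] | s <- all_bits w2]); last first.
    by elim: (all_bits w2) => //= s l <-; case: forb.
  rewrite -foldl_app; apply: eq_foldl_in => t'' s.
  rewrite mem_rev => /size_all_bits ss.
  rewrite run_forb //; try by lia.
    case: forb => //=; rewrite run_code //; rewrite ss; exact: lenb.
  by apply: leq_trans lew; rewrite leq_exp2l; lia.
(* A unary numeral is also a string of zero bits; with [true] in front it is the number of colors
   [2 ^ w2] in binary. *)
have -> : Cons (Cons [@ ] [@ ]) (un (q * b + q * b)) =
    tree_of_bits (true :: nseq w2 false).
  by rewrite /= tree_of_bitsE map_nseq.
have w2M : w2.+1 <= M by apply: leq_trans lew; apply: ltn_expl.
rewrite run_code; last by rewrite /= size_nseq.
have val0 m : bval (nseq m false) = 0.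
  by elim: m => // m IH; rewrite bval_cons IH.
rewrite bval_cons val0 size_nseq mul1n addn0.
(* The binary expansion of [N] is entry [N] of the list of all strings. *)
have -> : hd (of_seq (drop N [seq tree_of_bits i | i <- all_bits w2])) =
    tree_of_bits (nth [::] (all_bits w2) N).
  rewrite spine_hd of_seqK -nth0 nth_drop addn0 (nth_map [::]) //.
  by rewrite size_all_bitsE.
have NW : N < size (all_bits w2) by rewrite size_all_bitsE.
have sN := size_all_bits (mem_nth [::] NW).
rewrite run_code ?sN; last by lia.
rewrite -(nth_map [::] 0 bval) // bval_all_bits nth_iota // add0n.
by rewrite -[RHS]/(app gen_code Nil) !app_cat.
Qed.
End Generate.
Opaque f_gen.

(** * Reading the input *)

Definition nblocks (b : nat) : nat := b * b.
(** For [b > 0] this is the quotient of [2 ^ b] by [nblocks b], rounded up. *)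
Definition blocksize (b : nat) : nat := ((2 ^ b).-1 %/ nblocks b).+1.
(** With [q] the block size, the clock [2 ^ log_clock b] is the number [2 ^ (2 * q * b)] of
    distances times the factor [2 ^ (4 * b)]. *)
Definition log_clock (b : nat) : nat := (blocksize b + blocksize b + 4) * b.

Definition nat_pairs (n : nat) : seq (nat * nat) :=
  flatten [seq [seq (u, v) | v <- iota 0 n & u < v] | u <- iota 0 n].

Definition f_pow : fn := Fold $0 f_true (f_add @@ [:: $1; $1]).
(** The accumulator pairs the unread adjacency bits with the edges found. The ranges are reversed
    into increasing order because the bits are consumed in the order of [nat_pairs]. *)
Definition f_edges : fn :=
  Fold (f_rev @@ [:: f_iota @@ [:: $0]]) (Cn $1 Nl)
    (Fold (f_rev @@ [:: f_iota @@ [:: $2]]) $1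
       (Ite (f_lt $2 $0)
          (Cn (Tl (Hd $1)) (Ite (Hd (Hd $1)) (Cn (Cn $2 $0) (Tl $1)) (Tl $1)))
          $1)).
Definition f_bits : fn :=
  Fold $0 (Cn $1 Nl)
    (Ite (Hd (Hd $1))
       (Cn (Tl (Tl (Hd $1))) (Cn (Hd (Tl (Hd $1))) (Tl $1))) $1).
Definition f_divup : fn :=
  Tl (Fold $0 (Cn $0 Nl)
    (Ite (Hd $1) (Cn (f_drop @@ [:: $3; Hd $1]) (Cn Nl (Tl $1))) $1)).
(** If another bit is still announced after [b] bits of [k], the result is [n]. Otherwise the bits
    read are evaluated, their list also serving as the unary length. *)
Definition f_parse_k : fn :=
  Cp (Ite (Hd (Hd $1)) $0 (f_val @@ [:: Tl $1; Tl $1]))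
     (Cn $1 (Cn (f_bits @@ [:: $0; $2]) Nl)).
(** The head is the unary exponent of the clock under which the instance is written; the tail is the
    [data_tree]. *)
Definition f_data : fn :=
  Cn (f_mul @@ [:: f_add @@ [:: f_add @@ [:: $4; $4];
                     Cn Nl (Cn Nl (Cn Nl f_true))]; $0])
     (Cn $0 (Cn $1 (Cn $2 (Cn $3 (Cn $4 (Cn $5
       (Cn (f_mul @@ [:: $4; $0]) (Cn (f_add @@ [:: $5; $5]) Nl)))))))).
Definition f_parse_rest : fn :=
  f_data @@ [:: $0; $1; f_parse_k @@ [:: $0; $1; Hd $2]; Tl $2;
    f_divup @@ [:: f_pow @@ [:: $0]; f_mul @@ [:: $0; $0]];
    f_mul @@ [:: $0; $0]].
Definition f_parse : fn :=
  Cp (f_parse_rest @@ [:: $0; $1; f_edges @@ [:: $1; $2]])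
     (Cn (Fold $0 f_true (Cn Nl $1)) (Cn (f_val @@ [:: $0; $0]) (Cn $1 Nl))).

Lemma foldl_flatten (A T : Type) (f : T -> A -> T) (ss : seq (seq A)) z :
  foldl f z (flatten ss) = foldl (foldl f) z ss.
Proof. by elim: ss z => //= s ss IH z; rewrite foldl_cat IH. Qed.

Lemma foldl_filter (A T : Type) (f : T -> A -> T) (p : pred A) l z :
  foldl f z [seq y <- l | p y] = foldl (fun a y => if p y then f a y else a) z l.
Proof. by elim: l z => //= y l IH z; case: (p y) => /=. Qed.

Lemma run_edges M n B t : n <= M -> size B = size (nat_pairs n) ->
  run M f_edges [@ un n; app B t] =
  Cons t (edge_tree (rev (mask B (nat_pairs n)))).
Proof.
move=> nM sB.
pose F acc (e : nat * nat) := Cons (tl (hd acc))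
  (if truth (hd (hd acc)) then Cons (Cons (un e.1) (un e.2)) (tl acc) else tl acc).
transitivity (foldl F (Cons (app B t) Nil) (nat_pairs n)).
  rewrite /= run_iota // run_rev ?size_map ?size_rev ?size_iota //.
  rewrite -map_rev revK.
  rewrite of_seqK take_oversize ?size_map ?size_iota // foldl_mapE.
  rewrite foldl_flatten foldl_mapE; apply: eq_foldl_in => a u.
  rewrite mem_iota => /andP[_ un]; rewrite !foldl_mapE foldl_filter.
  by apply: eq_foldl_in => a' v _; rewrite run_lt //; lia.
have H (ps : seq (nat * nat)) E0 : size B = size ps ->
    foldl F (Cons (app B t) (edge_tree E0)) ps =
    Cons t (edge_tree (rev (mask B ps) ++ E0)).
  elim: ps B E0 {sB} => [|p ps IH] [|c B] E0 //= [sB].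
  by case: c => /=; rewrite /F /= (IH _ (p :: E0), IH) ?rev_cons ?cat_rcons.
by rewrite (H _ [::] sB) cats0.
Qed.
Opaque f_edges.

Lemma run_pow M b : 2 ^ b <= M -> run M f_pow [@ un b] = un (2 ^ b).
Proof.
move=> bM; have ltb := ltn_expl b (isT : 1 < 2).
rewrite /= take_spine !spine_un ?size_nseq //; last by lia.
elim: b bM {ltb} => // b IH bM.
have bM' : 2 ^ b <= M by apply: leq_trans bM; rewrite leq_exp2l.
rewrite -addn1 nseqD foldl_cat IH //= run_add //.
by rewrite addnn -mul2n -expnS addn1.
Qed.
Opaque f_pow.

Lemma run_bits M m s : m <= M ->
  run M f_bits [@ un m; app (bit_code s ++ [:: false]) Nil] =
  Cons (app (bit_code (drop m s) ++ [:: false]) Nil) (tree_of_bits (rev (take m s))).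
Proof.
move=> mM; rewrite /= take_spine !spine_un ?size_nseq //.
elim: m mM => [|m IH] mM; first by rewrite drop0 take0.
rewrite -[m.+1]addn1 nseqD foldl_cat IH ?[foldl _ _ _]/=; last by lia.
case: (ltnP m (size s)) => ms; last first.
  by rewrite !drop_oversize ?take_oversize //; lia.
rewrite (drop_nth false ms) addn1 (take_nth false ms) rev_rcons.
by case: nth.
Qed.
Opaque f_bits.

(** The program counts subtractions of [K] until nothing is left. In the invariant, [c] is the
    count: its last subtraction was useful, and either all [m] ticks were used or zero was reached.
    As [K] is positive, [P] ticks suffice. *)
Lemma run_divup M P K : 0 < P -> P <= M -> 0 < K -> K <= M ->
  run M f_divup [@ un P; un K] = un (P.-1 %/ K).+1.
Proof.
move=> P0 PM K0 KM; rewrite /= take_spine !spine_un ?size_nseq //.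
set F := fun _ _ => _.
have H m : exists c, [/\ foldl F (Cons (un P) Nil) (nseq m Nil) =
    Cons (un (P - c * K)) (un c), c = 0 \/ c.-1 * K < P & c = m \/ P <= c * K].
  elim: m => [|m [c [Ec c1 c2]]].
    by exists 0; split; [rewrite subn0|left|left].
  rewrite -addn1 nseqD foldl_cat Ec /F /= truth_spine spine_un size_nseq.
  case: (ltnP (c * K) P) => cP; last first.
    by exists c; rewrite ltn_subRL addn0 ltnNge cP; split=> //; right.
  exists c.+1; rewrite subn_gt0 cP run_sub //; split; last 2 first.
  - by right.
  - by left; lia.
  by rewrite mulSnr subnDA.
have [c [-> c1 c2]] := H P; rewrite /=; congr un.
have cP : P <= c * K.
  case: c2 => // ->; by rewrite leq_pmulr.
have c0 : 0 < c by case: c cP {c1 c2} => //; lia.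
have {}c1 : c.-1 * K < P by case: c1 => // c1; rewrite c1 in c0.
rewrite -[LHS](prednK c0); congr _.+1; apply/eqP; rewrite eqn_leq.
apply/andP; split; first by rewrite leq_divRL //; lia.
by rewrite -ltnS prednK // ltn_divLR //; lia.
Qed.
Opaque f_divup.

Lemma bval_rev_bits n : bval (rev (bits n)) = n.
Proof.
have [m] := ubnP n; elim: m n => // m IH n nm.
have [n2|n2] := leqP n 1; first by case: n n2 {nm} => [|[]].
rewrite -[in LHS](odd_double_half n) bits_double; last by lia.
by rewrite rev_cons bval_rcons IH ?odd_double_half //; lia.
Qed.

(* The size of the input is not bounded in terms of [n], because of [k]: only
   [b] bits of [k] may be read. *)
Definition cut_k (b n k : nat) : nat := if size (bits k) <= b then k else n.

Lemma size_bits n : size (bits n) = (trunc_log 2 n).+1.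
Proof. by rewrite size_map size_iota. Qed.

Lemma run_parse_k M b n k : b <= M -> 2 ^ b <= M ->
  run M f_parse_k [@ un b; un n; tree_of_bits (code_nat k)] = un (cut_k b n k).
Proof.
move=> bM b2M; rewrite -[tree_of_bits _]/(app (bit_code (bits k) ++ [:: false]) Nil).
rewrite /= run_bits // /cut_k.
case: (leqP (size (bits k)) b) => kb; last first.
  by rewrite (drop_nth false kb).
rewrite drop_oversize //= take_oversize // (@run_val _ _ (size (bits k))).
- by rewrite take_oversize ?size_rev // bval_rev_bits.
- by rewrite spine_bits size_map size_rev.
- by rewrite size_rev.
- by apply: leq_trans b2M; rewrite leq_exp2l.
Qed.
Opaque f_parse_k.

(** A clock of length [2 ^ (4 * b)] is enough for this stage, which outputs the exponent of the
    longer one. *)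
Lemma run_parse M rb B k :
  let b := (size rb).+1 in let n := bval rb in
  2 ^ (4 * b) <= M -> size B = size (nat_pairs n) ->
  run M f_parse [@ tree_of_bits rb; tree_of_bits (B ++ code_nat k)] =
  Cons (un (log_clock b))
    (data_tree n (cut_k b n k) b (blocksize b) (nblocks b)
       (rev (mask B (nat_pairs n)))).
Proof.
move=> b n leM sB.
have b2M : 2 ^ b <= M by apply: leq_trans leM; rewrite leq_exp2l; lia.
have bb := ltn_expl b (isT : 1 < 2).
have KM : b * b <= M.
  apply: leq_trans leM; rewrite (_ : 4 * b = b + b + (b + b)); last by lia.
  by rewrite expnD; apply: leq_trans (leq_pmulr _ _); rewrite ?expn_gt0 // expnD; apply: leq_mul; lia.
have nM : n < 2 ^ b.
  by apply: leq_trans (bval_lt rb) _; rewrite leq_exp2l.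
have qb : blocksize b <= 2 ^ b.
  rewrite /blocksize; have := leq_div (2 ^ b).-1 (nblocks b); lia.
have q4 : blocksize b + blocksize b + 4 <= M.
  apply: leq_trans leM; rewrite (_ : 4 * b = b + b + (b + b)); last by lia.
  have : 2 <= 2 ^ b by rewrite (@leq_exp2l 2 1).
  rewrite !expnD; move: (2 ^ b) qb => X qX X2.
  have h : 2 * X <= X * X by rewrite leq_mul2r X2 orbT.
  have : (2 * X) * (2 * X) <= X * X * (X * X) by apply: leq_mul.
  nia.
rewrite /= spine_bits take_oversize ?size_map; last by lia.
have -> : foldl (fun acc _ => Cons [@ ] acc) (Cons Nil Nil) (map tree_of_bool rb) = un b.
  rewrite /b -addn1; have H s m : foldl (fun acc _ => Cons Nil acc) (un m)
      (map tree_of_bool s) = un (size s + m).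
    by elim: s m => //= c s IH m; rewrite (IH m.+1) addnS.
  exact: (H rb 1).
rewrite (@run_val _ _ (size rb)) ?spine_bits ?size_map // ?take_oversize //; last first.
  by apply: leq_trans b2M; rewrite leq_exp2l.
rewrite -/n -[tree_of_bits _]/(app (B ++ code_nat k) Nil) app_cat.
rewrite run_edges //; last by lia.
rewrite /= run_pow // run_mul //; try by lia.
rewrite run_divup ?muln_gt0 ?expn_gt0 // -/(blocksize b).
rewrite !run_add; try by lia.
rewrite -[Cons Nil (Cons Nil (Cons Nil (Cons Nil Nil)))]/(un 4).
rewrite !run_add; try by lia.
rewrite !run_mul; try by lia.
by rewrite run_parse_k //; lia.
Qed.
Opaque f_parse.

(** * Correctness of the reduction *)

Definition msb (m d : nat) : seq bool := nth [::] (all_bits m) d.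

Lemma size_msb m d : d < 2 ^ m -> size (msb m d) = m.
Proof.
by move=> dm; apply: size_all_bits; apply: mem_nth; rewrite size_all_bitsE.
Qed.

Lemma msbK m d : d < 2 ^ m -> bval (msb m d) = d.
Proof.
move=> dm; rewrite -(nth_map [::] 0 bval) ?size_all_bitsE // bval_all_bits.
by rewrite nth_iota.
Qed.

Lemma bval_inj s t : size s = size t -> bval s = bval t -> s = t.
Proof.
elim: s t => [|b s IH] [|c t] //= [st]; rewrite !bval_cons st => e.
have := bval_lt s; have := bval_lt t; rewrite st => h1 h2.
have bc : b = c by case: b c e => [] []; lia.
by rewrite bc; congr cons; apply: IH => //; move: e; rewrite bc; lia.
Qed.

Lemma bvalK s : msb (size s) (bval s) = s.
Proof. by apply: bval_inj; rewrite ?size_msb ?msbK ?bval_lt. Qed.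

Lemma all_bitsE m : all_bits m = map (msb m) (iota 0 (2 ^ m)).
Proof.
apply: (@eq_from_nth _ [::]); first by rewrite size_map size_iota size_all_bitsE.
rewrite size_all_bitsE => i im; rewrite (nth_map 0) ?size_iota //.
by rewrite nth_iota.
Qed.

Lemma all_id_val s : all id s = (bval s == (2 ^ size s).-1).
Proof.
elim: s => //= b s IH; rewrite bval_cons expnS IH.
have := bval_lt s; have : 0 < 2 ^ size s by rewrite expn_gt0.
move: (2 ^ _) (bval s) => X v X0 vX; case: b => /=; lia.
Qed.

(** Cutting a string of [m + m] bits in half is Euclidean division of its value by [2 ^ m]: the
    first half is the quotient, the second the remainder. *)
Lemma bval_take m d : d < 2 ^ (m + m) -> bval (take m (msb (m + m) d)) = d %/ 2 ^ m.
Proof.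
move=> dm; have sd := size_msb dm.
have := msbK dm; rewrite -{1}(cat_take_drop m (msb (m + m) d)) bval_cat.
have := bval_lt (drop m (msb (m + m) d)); rewrite size_drop sd addnK => h e; rewrite -[in RHS]e.
by rewrite divnMDl ?expn_gt0 // divn_small // addn0.
Qed.

Lemma bval_drop m d : d < 2 ^ (m + m) -> bval (drop m (msb (m + m) d)) = d %% 2 ^ m.
Proof.
move=> dm; have sd := size_msb dm.
have := msbK dm; rewrite -{1}(cat_take_drop m (msb (m + m) d)) bval_cat.
have := bval_lt (drop m (msb (m + m) d)); rewrite size_drop sd addnK => h e; rewrite -[in RHS]e.
by rewrite modnMDl modn_small.
Qed.

Lemma pairsE n : map (fun p : 'I_n * 'I_n => (p.1 : nat, p.2 : nat)) (pairs n) = nat_pairs n.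
Proof.
rewrite /pairs /nat_pairs /allpairs_dep filter_flatten map_flatten.
rewrite -[iota 0 n]val_enum_ord -map_comp; congr flatten.
rewrite -2!map_comp; apply: eq_map => u /=.
by rewrite !filter_map -[LHS]map_comp -[RHS]map_comp.
Qed.

(** * The instance, its code and its proper assignments *)

Section Instance.
Variables (n k b q K : nat) (E : seq (nat * nat)).

Let w := q * b.
Let N := (K + K).+2.

(** All pairs are edges; a pair without constraint receives an empty forbidden set. *)
Definition complete_graph (m : nat) : graph :=
  @Graph m (fun u v => u != v)
    (fun u v => congr1 negb (eq_sym u v)) (fun u => congr1 negb (eqxx u)).

(** [forb] is oriented by the order of the indices while an edge is an unordered set; the quantifier
    recovers the ordered pair. Distances between colors stay below the cutoff [2 ^ (w + w)]. *)
Definition forb_set (e : {set 'I_N}) : {fset nat} :=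
  [fset d in [seq d <- iota 0 (2 ^ (w + w)) |
     [exists p : 'I_N * 'I_N, [&& p.1 < p.2, e == [set p.1; p.2] &
        forb n k b q K E p.1 p.2 (msb (w + w) d)]]]]%fset.

Definition instance : gtc := @Gtc (complete_graph N) forb_set (2 ^ (w + w)).

Lemma forb_setE (u v : 'I_N) d : u < v ->
  [exists p : 'I_N * 'I_N, [&& p.1 < p.2, [set u; v] == [set p.1; p.2] &
        forb n k b q K E p.1 p.2 (msb (w + w) d)]] =
  forb n k b q K E u v (msb (w + w) d).
Proof.
move=> uv; apply/existsP/idP => [[[x y] /and3P[/= xy /eqP e h]]|h]; last first.
  by exists (u, v); rewrite /= uv eqxx.
have : (x \in [set u; v]) && (y \in [set u; v]) by rewrite e !inE !eqxx orbT.
rewrite !inE => /andP[/orP[]/eqP ex /orP[]/eqP ey]; move: xy h; rewrite ex ey //.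
- by rewrite ltnn.
- by move=> ?; lia.
- by rewrite ltnn.
Qed.

Lemma sort_forb (u v : 'I_N) : u < v ->
  sort leq (forb_set [set u; v]) =
  [seq d <- iota 0 (2 ^ (w + w)) | forb n k b q K E u v (msb (w + w) d)].
Proof.
move=> uv.
rewrite -(eq_filter (fun d => forb_setE d uv)).
apply: (sorted_eq leq_trans anti_leq); first exact: (sort_sorted leq_total).
  by apply: (sorted_filter leq_trans); apply: iota_sorted.
rewrite perm_sort; apply: uniq_perm; rewrite ?fset_uniq ?filter_uniq ?iota_uniq //.
by move=> d; rewrite !inE.
Qed.

Lemma instance_code : gtc_code instance = gen_code n k b q K E.
Proof.
rewrite /gtc_code /gen_code; congr (_ ++ (_ ++ _)).
transitivity (flatten [seq pair_code n k b q K E p.1 p.2 | p <- nat_pairs N]).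
  rewrite -pairsE -map_comp; congr flatten; apply/eq_in_map => -[u v].
  rewrite mem_filter /= => /andP[uv _].
  rewrite /adj /= neq_ltn uv /= sort_forb // /pair_code uv; congr cons.
  congr (flatten _ ++ _); rewrite all_bitsE filter_map -map_comp.
  apply/eq_in_map => d; rewrite mem_filter mem_iota => /andP[_ /andP[_ dw]] /=.
  by rewrite msbK.
have inner x r : flatten [seq pair_code n k b q K E p.1 p.2 |
    p <- [seq (x, y) | y <- r & x < y]] =
  flatten [seq pair_code n k b q K E x y | y <- r].
  elim: r => //= y r <-; rewrite {2}/pair_code.
  by case: ltnP => //= xy; rewrite /pair_code xy.
rewrite /nat_pairs; have outer r l : flatten [seq pair_code n k b q K E p.1 p.2 |
    p <- flatten [seq [seq (x, y) | y <- r & x < y] | x <- l]] =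
  flatten [seq flatten [seq pair_code n k b q K E x y | y <- r] | x <- l].
  by elim: l => //= x l IH; rewrite map_cat flatten_cat IH inner.
exact: outer.
Qed.

Lemma instance_proper (c : 'I_N -> nat) :
  (forall v, 1 <= c v <= 2 ^ (w + w)) ->
  proper_assignment (I := instance) c <->
  forall u v : 'I_N, u < v ->
    ~~ forb n k b q K E u v (msb (w + w) `|c u - c v|).
Proof.
move=> cb.
have lt_s u v : `|c u - c v| < 2 ^ (w + w).
  by have := cb u; have := cb v; lia.
have mem (u v : 'I_N) : u < v -> (absz ((c u)%:Z - (c v)%:Z)%R \in forb_set [set u; v]) =
    forb n k b q K E u v (msb (w + w) `|c u - c v|).
  move=> uv; rewrite !inE mem_filter forb_setE // mem_iota lt_s.
  by rewrite andb_idr.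
split=> [H u v uv|H u v].
  by rewrite -mem //; apply: H; rewrite /= neq_ltn uv.
rewrite /= neq_ltn => /orP[] uv; first by rewrite mem // H.
by rewrite distnC finset.setUC mem // H.
Qed.

End Instance.

(** * Proper assignments correspond to compatible strings *)

Section Equivalence.
Variables (n k b q K : nat) (E : seq (nat * nat)).

Let w := q * b.
Let N := (K + K).+2.
Let D := 2 ^ w.
Let F := forb n k b q K E.

Let D_gt0 : 0 < D. Proof. by rewrite expn_gt0. Qed.

Let DD : 2 ^ (w + w) = D * D. Proof. exact: expnD. Qed.

Lemma forb_link x y d : x < K -> K <= y < K + K ->
  ~~ F x y (msb (w + w) d) = linked n k b q E x (y - K) (msb (w + w) d).
Proof. by move=> xK /andP[Ky yK]; rewrite /F /forb xK ltnNge Ky yK /= negbK. Qed.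

(** Once [K + K] has color 1, this confines the color of [x] to the range from 1 to [D]. *)
Lemma forb_low x d : x < K -> d < D * D ->
  ~~ F x (K + K) (msb (w + w) d) = (d < D).
Proof.
move=> xK dD; rewrite /F /forb xK ltnn ltnSn.
have -> : (K + K < K) = false by lia.
by rewrite bval_take ?DD // -leqNgt -ltnS ltn_divLR // mul1n.
Qed.

(** Once [K + K] has color 1, this makes the color of [x] a multiple of [D]. *)
Lemma forb_high x d : K <= x < K + K -> d < D * D ->
  ~~ F x (K + K) (msb (w + w) d) = (d %% D == D.-1).
Proof.
move=> /andP[Kx xK] dD; rewrite /F /forb ltnNge Kx xK ltnn ltnSn /= negbK.
by rewrite all_id_val bval_drop ?DD // size_drop size_msb ?DD // addnK.
Qed.

(** The only distance allowed is the largest one between two colors, so these two vertices take the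
    colors 1 and [D * D]. *)
Lemma forb_anchor d : d < D * D ->
  ~~ F (K + K) (K + K).+1 (msb (w + w) d) = (d == (D * D).-1).
Proof.
move=> dD; rewrite /F /forb ltnn.
have -> : (K + K < K) = false by lia.
rewrite ltnn negbK.
by rewrite all_id_val size_msb ?msbK ?DD.
Qed.

Definition solvable_strings : Prop := exists a c : nat -> seq bool,
  [/\ forall i, size (a i) = w, forall j, size (c j) = w &
      forall i j, i < K -> j < K -> linked n k b q E i j (c j ++ a i)].

Lemma strings_colors : solvable_strings -> gtc_yes (instance n k b q K E).
Proof.
case=> a [c [sa sc H]].
have va i : bval (a i) < D by rewrite /D -(sa i) bval_lt.
have vc j : bval (c j) < D by rewrite /D -(sc j) bval_lt.
pose col x := if x < K then D - bval (a x) else if x < K + K then D + D * bval (c (x - K))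
  else if x < (K + K).+1 then 1 else D * D.
have DvD j : D + D * bval (c j) <= D * D by rewrite -mulnS leq_mul2l vc orbT.
have cb x : 1 <= col x <= D * D.
  have h1 := va x; have h2 := DvD (x - K); rewrite /col.
  by case: ifP => _; [|case: ifP => _; [|case: ifP => _]]; nia.
have cb' (v : 'I_N) : 1 <= col v <= 2 ^ (w + w) by rewrite DD cb.
exists (fun v => col v); first exact: cb'.
apply/(instance_proper n k E cb') => u v uv; have := ltn_ord v; rewrite /N => vN.
rewrite -/w -/(F u v _).
move: (nat_of_ord u) (nat_of_ord v) uv vN => {}u {}v uv vN.
have dDD : `|col u - col v| < D * D by have := cb u; have := cb v; lia.
have colz : col (K + K) = 1.
  by rewrite /col ltnn ltnSn (_ : (K + K < K) = false) //; lia.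
have [uK|Ku] := ltnP u K.
  have [vK|Kv] := ltnP v K; first by rewrite /F /forb uK vK.
  have [vKK|KKv] := ltnP v (K + K).
    rewrite forb_link ?Kv //.
    (* The offsets cancel: subtracting [D - a] from [D + D * c] gives [D * c + a], the value of the
       concatenated string. *)
    suff -> : `|col u - col v| = bval (c (v - K) ++ a u).
      have sca : size (c (v - K) ++ a u) = w + w by rewrite size_cat sa sc.
      by rewrite -sca bvalK H //; lia.
    rewrite bval_cat sa -/D /col uK ltnNge Kv /= vKK; have := va u; nia.
  have [vK1|Kv1] := ltnP v (K + K).+1.
    have ev : v = K + K by lia.
    rewrite ev in dDD *; rewrite forb_low // colz /col uK; have := va u; lia.
  by rewrite /F /forb uK !ifF //; lia.
have [uKK|KKu] := ltnP u (K + K); last first.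
  have -> : u = K + K by lia.
  have -> : v = (K + K).+1 by lia.
  by rewrite forb_anchor /col ?ltnn ?ltnSn !ifF; lia.
have [vKK|KKv] := ltnP v (K + K); first by rewrite /F /forb ltnNge Ku uKK vKK.
have [vK1|Kv1] := ltnP v (K + K).+1; last by rewrite /F /forb ltnNge Ku uKK !ifF //; lia.
have ev : v = K + K by lia.
rewrite ev in dDD *; rewrite forb_high ?Ku //.
have -> : `|col u - col (K + K)%N| = bval (c (u - K)) * D + D.-1.
  by rewrite colz /col ltnNge Ku uKK /=; nia.
by rewrite modnMDl modn_small; lia.
Qed.

Lemma colors_strings : gtc_yes (instance n k b q K E) -> solvable_strings.
Proof.
case=> c0 cb0 /(instance_proper n k E cb0) H0.
rewrite -/w -/N -/F in H0.
pose c1 (x : nat) := c0 (inord x : 'I_N).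
have cb1 x : 1 <= c1 x <= D * D by rewrite -DD cb0.
have H1 x y : x < y -> y < N -> ~~ F x y (msb (w + w) `|c1 x - c1 y|).
  move=> xy yN; have := H0 (inord x : 'I_N) (inord y : 'I_N).
  by rewrite !inordK //; [exact|rewrite -/N; lia].
have [c [cb H c2K]] : exists c : nat -> nat, [/\ forall x, 1 <= c x <= D * D,
    forall x y, x < y -> y < N -> ~~ F x y (msb (w + w) `|c x - c y|) & c (K + K) = 1].
  have := H1 (K + K) (K + K).+1 (ltnSn _) (ltnSn _).
  rewrite forb_anchor; last by have := cb1 (K + K); have := cb1 (K + K).+1; lia.
  have := cb1 (K + K); have := cb1 (K + K).+1 => h h' /eqP e.
  have [e1|e1] := eqVneq (c1 (K + K)) 1; first by exists c1.
  (* reflecting the colors preserves the distances and exchanges 1 and [D * D] *)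
  exists (fun x => (D * D).+1 - c1 x); split=> [x|x y xy yN|]; last by lia.
    by have := cb1 x; lia.
  suff -> : `|((D * D).+1 - c1 x)%N - ((D * D).+1 - c1 y)%N| = `|c1 x - c1 y| by exact: H1.
  by have := cb1 x; have := cb1 y; lia.
have low i : i < K -> c i <= D.
  move=> iK; have := H i (K + K) ltac:(lia) ltac:(rewrite /N; lia).
  by rewrite forb_low // c2K; have := cb i; lia.
have high j : j < K -> exists2 v, v < D & c (K + j) = v * D + D.
  move=> jK; have := H (K + j) (K + K) ltac:(lia) ltac:(rewrite /N; lia).
  have := cb (K + j) => h; rewrite c2K forb_high; [|by lia|by lia].
  have -> : `|c (K + j)%N - 1%N| = c (K + j) - 1 by lia.
  move=> /eqP e; exists ((c (K + j) - 1) %/ D); last first.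
    by have := divn_eq (c (K + j) - 1) D; rewrite e; lia.
  by rewrite ltn_divLR //; lia.
(* Clamping by [D.-1] gives all strings length [w], also at indices outside the range; at indices
   below [K] it changes nothing. *)
pose a i := msb w (minn (D - c i) D.-1).
pose u j := msb w (minn (c (K + j) %/ D).-1 D.-1).
have mD x : minn x D.-1 < 2 ^ w by rewrite -/D; lia.
exists a, u; split=> [i|j|i j iK jK]; rewrite ?size_msb //.
have := H i (K + j) ltac:(lia) ltac:(rewrite /N; lia).
rewrite forb_link //; last by lia.
have [v vD ev] := high j jK; have ci := low i iK; have := cb i => /andP[ci1 _].
rewrite addKn; congr (is_true (linked _ _ _ _ _ _ _ _)).
apply: bval_inj.
  by rewrite size_cat !size_msb // DD; have := cb i; have := cb (K + j); lia.
rewrite bval_cat msbK; last by rewrite DD; have := cb i; have := cb (K + j); lia.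
rewrite !msbK // size_msb // -/D ev -mulSnr mulnK //=.
have -> : minn v D.-1 = v by lia.
have -> : minn (D - c i) D.-1 = D - c i by lia.
nia.
Qed.

End Equivalence.

Lemma chunk_catl b s t c : c * b + b <= size s -> chunk b (s ++ t) c = chunk b s c.
Proof.
case: b => [|b] h; first by rewrite /chunk !take0.
rewrite /chunk drop_cat ifT; last by lia.
by rewrite takel_cat // size_drop; lia.
Qed.

Lemma chunk_catr b s t q c : size s = q * b -> chunk b (s ++ t) (c + q) = chunk b t c.
Proof.
move=> ss; rewrite /chunk drop_cat ss mulnDl ifF; last by lia.
by rewrite addnK.
Qed.

Lemma chunk_flatten b (ss : seq (seq bool)) c : all (fun s => size s == b) ss ->
  c < size ss -> chunk b (flatten ss) c = bval (nth [::] ss c).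
Proof.
rewrite /chunk; elim: ss c => //= s ss IH [|c] /andP[/eqP sb ass] cs.
  by rewrite drop0 -sb take_size_cat.
by rewrite drop_cat sb mulSn ifF ?addKn ?IH //; lia.
Qed.

Definition ds_edges (G : graph) : seq (nat * nat) :=
  rev (mask [seq adj p.1 p.2 | p <- pairs (nverts G)] (nat_pairs (nverts G))).

Lemma ds_edgesP (G : graph) (x y : nat) :
  reflect (exists u v : 'I_(nverts G), [/\ u < v, adj u v, x = u :> nat & y = v :> nat])
          ((x, y) \in ds_edges G).
Proof.
rewrite mem_rev -pairsE -map_mask -filter_mask; apply: (iffP mapP).
  case=> -[u v]; rewrite !mem_filter /= => /and3P[auv uv _] [-> ->].
  by exists u, v.
case=> u [v [uv auv -> ->]]; exists (u, v) => //=.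
by rewrite !mem_filter /= auv uv allpairs_f ?mem_enum.
Qed.

Lemma near_eqP (G : graph) (x : nat) (v : 'I_(nverts G)) :
  reflect (exists2 u : 'I_(nverts G), u = x :> nat & u = v \/ adj u v)
          (near_eq (ds_edges G) x v).
Proof.
apply: (iffP orP) => [[/eqP xv|/hasP[[y z] /ds_edgesP[u [u' [uu' auu' ey ez]]] /=]]|].
- by exists v => //; left.
- rewrite {}ey {}ez => /orP[]/andP[/eqP e /eqP e'].
    by exists u => //; right; rewrite -(val_inj e').
  by exists u' => //; right; rewrite -(val_inj e) adj_sym.
case=> u <- [->|auv]; first by left.
right; case: (ltngtP u v) => uv.
- apply/hasP; exists (u : nat, v : nat); last by rewrite /= !eqxx.
  by apply/ds_edgesP; exists u, v.
- apply/hasP; exists (v : nat, u : nat); last by rewrite /= !eqxx orbT.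
  by apply/ds_edgesP; exists v, u; rewrite adj_sym.
- by rewrite (val_inj uv) adj_irr in auv.
Qed.

(** * Compatible strings correspond to dominating sets *)

Section DominatingSet.
Variables (G : graph) (k b q K : nat).
Let n := nverts G.
Let E := ds_edges G.
Hypotheses (nb : n < 2 ^ b) (bKq : 2 ^ b <= K * q).

Let q_gt0 : 0 < q.
Proof. by case: q bKq => //; rewrite muln0 leqn0 expn_eq0. Qed.

Let block (f : nat -> nat) (i : nat) : seq bool :=
  flatten [seq msb b (f (i * q + t)) | t <- iota 0 q].

Lemma block_all f i : (forall x, f x < 2 ^ b) ->
  all (fun s => size s == b) [seq msb b (f (i * q + t)) | t <- iota 0 q].
Proof. by move=> fb; apply/allP => s /mapP[t _ ->]; rewrite size_msb. Qed.

Lemma size_block f i : (forall x, f x < 2 ^ b) -> size (block f i) = q * b.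
Proof.
move=> fb; rewrite size_flatten /shape -map_comp.
rewrite (eq_map (g := fun=> b)) => [|t /=]; last by rewrite size_msb.
by rewrite sumnE big_map big_const_seq count_predT size_iota iter_addn_0 mulnC.
Qed.

Lemma chunk_block f i t : (forall x, f x < 2 ^ b) -> t < q ->
  chunk b (block f i) t = f (i * q + t).
Proof.
move=> fb tq; rewrite chunk_flatten ?block_all ?size_map ?size_iota //.
by rewrite (nth_map 0) ?size_iota // nth_iota // add0n msbK.
Qed.

Lemma ds_strings : ds_yes (G, k) -> solvable_strings n k b q K E.
Proof.
case=> D /= Dk domD; pose l := [seq val u | u <- enum D].
have sl : size l = #|D| by rewrite size_map -cardE.
(* Past the end of the list the entries default to 0; no vertex points to such a position. *)
pose entry := nth 0 l.
have entry_lt x : entry x < 2 ^ b.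
  rewrite /entry; have [xl|xl] := ltnP x (size l); last first.
    by rewrite nth_default // expn_gt0.
  have /mapP[u _ ->] := mem_nth 0 xl.
  exact: ltn_trans (ltn_ord u) nb.
have has_dom v : v < n -> has (near_eq E ^~ v) l.
  move=> vn; have [vD|[u uD auv]] := domD (Ordinal vn).
    apply/hasP; exists v; last by rewrite /near_eq eqxx.
    by apply/mapP; exists (Ordinal vn); rewrite ?mem_enum.
  apply/hasP; exists (val u); first by rewrite map_f ?mem_enum.
  by apply/(near_eqP _ (Ordinal vn)); exists u => //; right.
(* The first position whose entry dominates [v]. The value 0 beyond [n] only fills up the last
   blocks. *)
pose dom v := if v < n then find (near_eq E ^~ v) l else 0.
have dom_lt x : dom x < 2 ^ b.
  rewrite /dom; case: (ltnP x n) => xn; last by rewrite expn_gt0.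
  apply: leq_ltn_trans nb; apply: leq_trans (find_size _ _) _.
  by rewrite sl -[n]card_ord max_card.
exists (block entry), (block dom); split=> [i|j|i j iK jK]; rewrite ?size_block //.
apply/allP => t; rewrite mem_iota => /andP[_ tq]; apply/implyP => vn.
have -> : chunk b (block dom j ++ block entry i) t = dom (j * q + t).
  rewrite chunk_catl ?chunk_block // size_block // -mulSnr leq_mul2r; lia.
have hd := has_dom _ vn.
have dl : dom (j * q + t) < size l by rewrite /dom vn -has_find.
rewrite (leq_trans dl) ?sl //=; apply/implyP => /andP[h1 h2].
rewrite (chunk_catr _ _ (size_block _ dom_lt)) chunk_block //; last by lia.
rewrite subnKC // /entry /dom vn.
exact: (nth_find 0 hd).
Qed.

(** The set consists of the vertices named by the first [k] entries: repetitions, and entries that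
    are not vertices, can only make it smaller. *)
Lemma strings_ds : solvable_strings n k b q K E -> ds_yes (G, k).
Proof.
case=> a [c [sa sc H]].
pose entry p := chunk b (a (p %/ q)) (p %% q).
pose D := [set v : 'I_n | val v \in map entry (iota 0 k)].
have D_in (v : 'I_n) : (v \in D) = (val v \in map entry (iota 0 k)) by rewrite inE.
exists D.
  rewrite /= cardE -(size_map (@nat_of_ord n)) -[X in _ <= X](size_iota 0) -(size_map entry (iota 0 k)).
  apply: uniq_leq_size; first by rewrite (map_inj_uniq (@ord_inj n)) enum_uniq.
  by move=> x /mapP[u]; rewrite mem_enum D_in => + ->.
move=> v; set j := v %/ q; set t := v %% q.
have tq : t < q by rewrite ltn_mod.
have vE : j * q + t = v by rewrite -divn_eq.
have jK : j < K.
  by rewrite ltn_divLR //; apply: leq_trans bKq; apply: ltn_trans nb; exact: ltn_ord.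
have tb : t * b + b <= q * b by rewrite -mulSnr leq_mul2r tq orbT.
set p := chunk b (c j) t.
have pb : p < 2 ^ b.
  rewrite /p /chunk; have := bval_lt (take b (drop (t * b) (c j))).
  by rewrite size_takel // size_drop sc; lia.
(* The condition for [v] has content only for the block containing the position [p]; since the
   blocks cover all values below [2 ^ b], this block exists. *)
have iK : p %/ q < K by rewrite ltn_divLR //; exact: leq_trans pb bKq.
have := H _ _ iK jK; move=> /allP/(_ t); rewrite mem_iota tq => /(_ isT).
rewrite /link_at vE ltn_ord /= chunk_catl ?sc // -/p => /andP[pk].
rewrite leq_trunc_div /= {1}(divn_eq p q) ltn_add2l ltn_mod q_gt0 /=.
rewrite (_ : p - _ = p %% q); last by rewrite {1}(divn_eq p q) addKn.
rewrite chunk_catr ?sc // -/(entry p) => /near_eqP[u eu uv].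
have uD : u \in D.
  by rewrite D_in; apply/mapP; exists p; rewrite ?mem_iota.
by case: uv => [<-|auv]; [left|right; exists u].
Qed.

End DominatingSet.

(** If [k] has more than [b] bits, it is at least the number of vertices, and the full vertex set
    answers both questions. *)
Lemma cut_k_yes (G : graph) k b : nverts G < 2 ^ b ->
  ds_yes (G, cut_k b (nverts G) k) <-> ds_yes (G, k).
Proof.
move=> nb; rewrite /cut_k size_bits; case: ltnP => // kb.
have kn : nverts G <= k.
  have [k0|k0] := posnP k.
    (* [bits 0] has one digit, so [k = 0] leads here only if [b = 0], and then the graph is
       empty. *)
    by move: kb nb; rewrite k0 trunc_log0 leqn0 => /eqP->; lia.
  apply/ltnW/(leq_trans nb).
  by apply: leq_trans (trunc_logP (isT : 1 < 2) k0); rewrite leq_exp2l.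
split=> _; exists [set: 'I_(nverts G)]; rewrite /= ?cardsT ?card_ord //.
- by move=> v; left; rewrite inE.
- by move=> v; left; rewrite inE.
Qed.

(** * The reduction as a command *)

(** The bits of [n] are reversed into [m.+1]. Each of them adds four cells to [m.+4]; with the four
    already there, this makes the exponent [4 * width n] of the first clock. *)
Definition read_bits (m : nat) : cmd :=
  While (EHd (Var m))
    (Seq (Assign m.+1 (ECons (EHd (ETl (Var m))) (Var m.+1)))
    (Seq (Assign m.+4 (ECons ENil (ECons ENil (ECons ENil (ECons ENil (Var m.+4))))))
         (Assign m (ETl (ETl (Var m)))))).

(* [m] bounds the variables of [A], which are still [Nil] when [A] starts. *)
Definition reduction_cmd (m : nat) (A : cmd) : cmd :=
  Seq (Assign m (Var 0))
  (Seq (Assign m.+4 (ECons ENil (ECons ENil (ECons ENil (ECons ENil ENil)))))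
  (Seq (read_bits m)
  (Seq (Assign m (ETl (Var m)))
  (Seq (pow2 m.+4 m.+2 m.+3)
  (Seq (Assign m.+4.+1 (ECons (Var m.+1) (ECons (Var m) ENil)))
  (Seq (compile m.+2 f_parse m.+4.+1)
  (Seq (Assign m (ETl (Var m.+4.+1)))
  (Seq (Assign m.+4 (EHd (Var m.+4.+1)))
  (Seq (pow2 m.+4 m.+2 m.+3)
  (Seq (Assign m.+4.+1 (ECons (Var m) ENil))
  (Seq (compile m.+2 f_gen m.+4.+1)
  (Seq (Assign 0 (Var m.+4.+1)) A)))))))))))).

Lemma read_bitsP m s t (st : store) :
  st m = app (bit_code s ++ [:: false]) t -> exists st',
  [/\ exec_le st (read_bits m) st' (25 * size s + 3),
      st' m = app [:: false] t,
      spine (st' m.+1) = rev (map tree_of_bool s) ++ spine (st m.+1),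
      size (spine (st' m.+4)) = 4 * size s + size (spine (st m.+4)) &
      forall y, y < m -> st' y = st y].
Proof.
elim: s st => [|c s IH] st E.
  exists st; split=> //.
  by apply: exec_leW (le_while_false _ _) _ => /=; rewrite ?E.
pose e1 := ECons (EHd (ETl (Var m))) (Var m.+1).
pose e2 := ECons ENil (ECons ENil (ECons ENil (ECons ENil (Var m.+4)))).
pose s1 := upd st m.+1 (Cons (hd (tl (st m))) (st m.+1)).
pose s2 := upd s1 m.+4 (Cons Nil (Cons Nil (Cons Nil (Cons Nil (s1 m.+4))))).
pose s3 := upd s2 m (tl (tl (s2 m))).
have x1 : exec_le st (Assign m.+1 e1) s1 6 by exact: le_assign.
have x2 : exec_le s1 (Assign m.+4 e2) s2 10 by exact: le_assign.
have x3 : exec_le s2 (Assign m (ETl (ETl (Var m)))) s3 4 by exact: le_assign.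
have E2 : s2 m = st m by rewrite /s2 /s1 !updN //; lia.
have [|s' [x' v1 v2 v3 f]] := IH s3; first by rewrite /s3 updE E2 E.
exists s'; split.
- apply: exec_leW (le_while_true _ (le_seq x1 (le_seq x2 x3)) x') _.
    by rewrite /= E.
  rewrite /=; lia.
- exact: v1.
- rewrite v2 /s3 updN /s2 ?updN /s1 ?updE //; try by lia.
  by rewrite E /= rev_cons cat_rcons.
- rewrite v3 /s3 updN; last by lia.
  rewrite /s2 updE /s1 updN /=; lia.
- by move=> y ym; rewrite f // /s3 /s2 /s1 !updN //; lia.
Qed.

(** The extra digit makes the width at least 2 for every [n], as the size bounds require. *)
Definition width (n : nat) : nat := (size (bits n)).+1.

Definition ds_instance (J : graph * nat) : gtc :=
  let n := nverts J.1 in let b := width n in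
  instance n (cut_k b n J.2) b (blocksize b) (nblocks b) (ds_edges J.1).

Lemma width_ge2 n : 2 <= width n.
Proof. by rewrite /width size_bits. Qed.

Lemma lt_width n : n < 2 ^ width n.
Proof.
have := bval_lt (rev (bits n)); rewrite bval_rev_bits size_rev => h.
by apply: leq_trans h _; rewrite leq_exp2l // /width.
Qed.

(** * Bounds on the parameters and on the size of the instance *)

Section Sizes.
Variable b : nat.
Hypothesis b2 : 2 <= b.
Let q := blocksize b.
Let K := nblocks b.
Let w2 := q * b + q * b.

Lemma nblocks_gt0 : 0 < K.
Proof. by rewrite muln_gt0; lia. Qed.

Lemma cover_blocks : 2 ^ b <= K * q.
Proof.
have h := ltn_ceil (2 ^ b).-1 nblocks_gt0.
by rewrite -(prednK (_ : 0 < 2 ^ b)) ?expn_gt0 // mulnC.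
Qed.

Lemma blocks_le : K * q <= 2 ^ b + K.
Proof.
rewrite /q /blocksize mulnS -/K addnC leq_add2r mulnC.
by apply: leq_trans (leq_trunc_div _ _) (leq_pred _).
Qed.

Lemma log_clockE : log_clock b = w2 + 4 * b.
Proof. by rewrite /log_clock !mulnDl. Qed.

(** The factor [2 ^ w2] of the clock covers the enumeration of distances, the factor [2 ^ (4 * b)]
    everything polynomial in [2 ^ b]. *)
Lemma clock_bounds (M := 2 ^ log_clock b) :
  [/\ 2 ^ (4 * b) <= M, K * q + q <= M, w2 <= M, (K + K).+2 <= M & 2 ^ w2 <= M].
Proof.
have ME : M = 2 ^ w2 * (2 ^ b * 2 ^ b * (2 ^ b * 2 ^ b)).
  rewrite /M log_clockE !expnD; congr (_ * _).
  by rewrite -!expnD; congr (2 ^ _); lia.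
have X4 : 4 <= 2 ^ b by rewrite (@leq_exp2l 2 2).
have bX := ltn_expl b (isT : 1 < 2).
have KX : K <= 2 ^ b * 2 ^ b by apply: leq_mul; lia.
have KqX := blocks_le.
have qKq : q <= K * q by rewrite leq_pmull // nblocks_gt0.
have w2X : w2 <= 2 ^ w2 by apply/ltnW/ltn_expl.
have Y0 : 0 < 2 ^ w2 by rewrite expn_gt0.
have M0 : 2 ^ (4 * b) <= M by rewrite leq_exp2l // log_clockE; lia.
have {ME} [MX MY] : 16 * (2 ^ b * 2 ^ b) <= M /\ 2 ^ w2 <= M.
  rewrite ME; move: (2 ^ w2) (2 ^ b) X4 Y0 => Y X X4 Y0; split; last first.
    by rewrite leq_pmulr // !muln_gt0; lia.
  apply: leq_trans (leq_pmull _ Y0); rewrite leq_mul2r; apply/orP; right.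
  by apply: (@leq_mul 4 4 X X).
have XX : 2 ^ b <= 2 ^ b * 2 ^ b by rewrite leq_pmulr; lia.
by split=> //; lia.
Qed.

Lemma vertices_lt : (K + K).+2 < 2 ^ w2.
Proof.
have bw : b + b <= w2 by rewrite leq_add // leq_pmull.
apply: leq_trans (_ : _ <= 2 ^ (b + b)) _; last by rewrite leq_exp2l.
rewrite /K /nblocks; elim: b b2 {bw} => // c IH; rewrite leq_eqVlt => /orP[/eqP<- //|c2].
have := IH c2; rewrite addSn addnS !expnS; nia.
Qed.

End Sizes.

Lemma size_ds_edges G : size (ds_edges G) <= nverts G * nverts G.
Proof.
rewrite size_rev -pairsE -map_mask size_map -filter_mask.
rewrite size_filter (leq_trans (count_size _ _)) // size_filter.
by rewrite (leq_trans (count_size _ _)) // size_allpairs size_enum_ord.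
Qed.

Lemma run_ds_gen (J : graph * nat) (b := width (nverts J.1)) :
  run (2 ^ log_clock b) f_gen [@ data_tree (nverts J.1) (cut_k b (nverts J.1) J.2) b
    (blocksize b) (nblocks b) (ds_edges J.1)] = tree_of_bits (gtc_code (ds_instance J)).
Proof.
have b2 := width_ge2 (nverts J.1); rewrite -/b in b2.
have nb := lt_width (nverts J.1); rewrite -/b in nb.
have [h1 h2 h3 h4 h5] := clock_bounds b2.
have XX : 2 ^ b * 2 ^ b <= 2 ^ log_clock b.
  by apply: leq_trans h1; rewrite -expnD leq_exp2l //; lia.
have XM : 2 ^ b <= 2 ^ log_clock b.
  by apply: leq_trans XX; rewrite leq_pmulr ?expn_gt0.
rewrite /ds_instance -/b instance_code run_gen //; try by lia.
- by apply: leq_trans (size_ds_edges _) (leq_trans _ XX); apply: leq_mul; lia.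
- move=> [x y] /ds_edgesP[u [v [_ _ -> ->]]] /=.
  by have := ltn_ord u; have := ltn_ord v; lia.
- exact: vertices_lt.
Qed.

Lemma ds_instance_yes (J : graph * nat) : gtc_yes (ds_instance J) <-> ds_yes J.
Proof.
case: J => G k; set b := width (nverts G).
have b2 : 2 <= b := width_ge2 _.
have nb : nverts G < 2 ^ b := lt_width _.
rewrite -(cut_k_yes _ nb); split.
  by move=> h; apply: (strings_ds nb (cover_blocks b2)); exact: colors_strings.
by move=> h; apply: strings_colors; apply: (ds_strings nb (cover_blocks b2)).
Qed.

(** The exact value matters: the exponent in (ii) is an arbitrary function of the largest forbidden
    distance, not a monotone one. *)
Lemma ds_instance_max (J : graph * nat) (b := width (nverts J.1)) :
  max_forbidden (ds_instance J) = (2 ^ (blocksize b * b + blocksize b * b)).-1.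
Proof.
have b2 : 2 <= b := width_ge2 _.
set w2 := _ + _; apply/eqP; rewrite eqn_leq; apply/andP; split.
  apply/bigmax_leqP => p _; apply/bigmax_leqP_seq => d.
  rewrite !inE mem_filter mem_iota => /andP[_ /andP[_ dw]] _.
  by move: dw; rewrite -/b -/w2; lia.
have K0 := nblocks_gt0 b2; set K := nblocks b in K0.
(* Between vertex 0 and vertex [K + K] every distance from [D] on is forbidden, in particular the
   largest. *)
pose u : 'I_(K + K).+2 := inord 0; pose v : 'I_(K + K).+2 := inord (K + K).
have uE : u = 0 :> nat by rewrite inordK.
have vE : v = K + K :> nat by rewrite inordK.
have uv : u < v by rewrite uE vE; lia.
apply: (bigmax_sup (u, v)); first by rewrite /= neq_ltn uv.
apply: (@leq_bigmax_seq _ _ xpredT (fun d => d)) => //.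
rewrite !inE mem_filter (forb_setE _ _ _ _ _ _ uv) mem_iota /= add0n.
rewrite prednK ?expn_gt0 // leqnn andbT uE vE.
rewrite -[X in is_true X]negbK forb_low //.
  rewrite -leqNgt expnD; have : 2 <= 2 ^ (blocksize b * b).
    by rewrite (@leq_exp2l 2 1) // muln_gt0; lia.
  move: (2 ^ _) => X; nia.
by rewrite -expnD prednK // expn_gt0.
Qed.

Lemma size_code_nat n : size (code_nat n) = (2 * size (bits n)).+1.
Proof.
rewrite /code_nat /code_list size_cat addn1; congr _.+1.
by elim: (bits n) => //= b s ->; lia.
Qed.

Lemma size_flatten_le (T S : eqType) (f : T -> seq S) (l : seq T) m B :
  size l <= m -> (forall x, x \in l -> size (f x) <= B) ->
  size (flatten (map f l)) <= m * B.
Proof.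
move=> lm H; apply: leq_trans (leq_mul lm (leqnn B)).
elim: l {lm} H => //= x l IH H; rewrite size_cat mulSn leq_add ?H ?mem_head //.
by apply: IH => y yl; rewrite H // inE yl orbT.
Qed.

Lemma size_bits_le n m : n <= 2 ^ m -> size (bits n) <= m.+1.
Proof.
rewrite size_bits ltnS => nm; have := leq_trunc_log 2 nm.
by rewrite trunc_expnK.
Qed.

(** There are at most [N * N] pairs, each with at most [X] distances of at most [2 * w2 + 4] bits;
    [N] and [w2] are at most the clock [X], hence the fourth power. *)
Lemma ds_instance_size (J : graph * nat) :
  bit_size (ds_instance J) <= 40 * (2 ^ log_clock (width (nverts J.1))) ^ 4.
Proof.
set b := width _; have b2 : 2 <= b := width_ge2 _.
have [_ _ h3 h4 h5] := clock_bounds b2.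
rewrite /bit_size instance_code -/b /gen_code size_cat size_code_nat size_cat size_code_nat.
set w2 := blocksize b * b + _ in h3 h5 *.
have KW := vertices_lt b2; rewrite -/w2 in KW.
set N := (nblocks b + nblocks b).+2 in h4 KW *.
set X := 2 ^ log_clock b in h3 h4 h5 *.
have bN : size (bits N) <= w2.+1 by apply: size_bits_le; exact: ltnW.
have bs : size (bits (2 ^ w2)) <= w2.+1 by exact: size_bits_le.
set l := flatten _.
have : size l <= N * (N * (X * (2 * w2 + 4) + 2)).
  apply: size_flatten_le => [|x _]; first by rewrite size_iota.
  apply: size_flatten_le => [|y _]; first by rewrite size_iota.
  have sz (s : seq bool) : size (true :: s ++ [:: false]) = (size s).+2.
    by rewrite /= size_cat addn1.
  rewrite /pair_code; case: ifP => // _; rewrite sz addn2 !ltnS.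
  apply: size_flatten_le => [|s].
    rewrite size_filter; apply: leq_trans (count_size _ _) _.
    by rewrite size_all_bitsE.
  rewrite mem_filter => /andP[_ /size_all_bits ss].
  rewrite -[size _]/(size (code_nat _)).+1 size_code_nat; suff : size (bits (bval s)) <= w2.+1 by lia.
  by apply: size_bits_le; have := bval_lt s; rewrite ss; exact: ltnW.
have X1 : 0 < X by rewrite expn_gt0.
move: (size l) (size (bits N)) (size (bits (2 ^ w2))) bN bs h3 h4 X1.
clearbody X w2 N; clear => L x y bN bs h3 h4 X1 HL.
have H1 : N * (N * (X * (2 * w2 + 4) + 2)) <= X * (X * (X * (2 * X + 4) + 2)).
  by do 2 apply: leq_mul => //; rewrite leq_add2r leq_mul2l; apply/orP; right; lia.
have -> : X ^ 4 = X * (X * (X * X)) by rewrite !expnS expn0 muln1.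
have X2 : X <= X * X by rewrite leq_pmulr.
have X3 : X * X <= X * (X * X) by rewrite leq_pmull.
have X4 : X * (X * X) <= X * (X * (X * X)) by rewrite leq_pmull.
have E : X * (X * (X * (2 * X + 4) + 2)) =
  2 * (X * (X * (X * X))) + 4 * (X * (X * X)) + 2 * (X * X) by ring.
move: HL H1 X2 X3 X4; rewrite E.
move: (X * (X * (X * X))) (X * (X * X)) (X * X) (N * _) => *; lia.
Qed.

Lemma runtime_le p : exists C d, forall M X e, M <= X -> 0 < X -> d <= e ->
  runtime M p <= C * X ^ e.
Proof.
have [C [d H]] := runtime_poly p; exists (C * 2 ^ d), d => M X e MX X0 de.
apply: leq_trans (H M) _; rewrite -mulnA leq_mul2l; apply/orP; right.
apply: (@leq_trans ((2 * X) ^ d)); last by rewrite expnMn leq_mul2l leq_pexp2l ?orbT.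
by case: d {H de} => // d; rewrite leq_exp2r //; lia.
Qed.

Lemma reduction (A : cmd) : exists B C d, forall (J : graph * nat) ans T,
  outputs A (gtc_code (ds_instance J)) ans T ->
  exists2 T', outputs B (ds_code J) ans T' &
    T' <= C * (2 ^ log_clock (width (nverts J.1))) ^ d + T.
Proof.
have [Cp [dp Hp]] := runtime_le f_parse.
have [Cg [dg Hg]] := runtime_le f_gen.
(* The 1 keeps variable 0, which holds the input, out of the scratch space. *)
pose m := maxn (cvars A) 1.
exists (reduction_cmd m A), (Cp + Cg + 120), (dp + dg).+1 => -[G k] ans T [sA exA vA].
set n := nverts G; set b := width n.
have b2 : 2 <= b := width_ge2 _.
have [h1 _ _ _ _] := clock_bounds b2.
set X := 2 ^ log_clock b in h1 *.
have X0 : 0 < X by rewrite expn_gt0.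
set s0 := init (ds_code (G, k)).
have m0 : 0 < m by rewrite /m; lia.
have s0E y : 0 < y -> s0 y = Nil by move=> ?; rewrite /s0 /init updN //; lia.
pose s1 := upd s0 m (s0 0).
have x1 : exec_le s0 (Assign m (Var 0)) s1 2 by exact: le_assign.
pose s2 := upd s1 m.+4 (un 4).
have x2 : exec_le s1 (Assign m.+4 (ECons ENil (ECons ENil (ECons ENil (ECons ENil ENil)))))
  s2 10 by exact: le_assign.
pose B := [seq adj p.1 p.2 | p <- pairs n].
have s2m : s2 m = app (bit_code (bits n) ++ [:: false]) (tree_of_bits (B ++ code_nat k)).
  rewrite /s2 updN; last by lia.
  rewrite /s1 updE -app_cat; exact: updE.
have [s3 [x3 v3 rb3 w3 f3]] := read_bitsP s2m.
have {rb3} rb3 : spine (s3 m.+1) = map tree_of_bool (rev (bits n)).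
  rewrite rb3 /s2 updN /s1 ?updN ?s0E //; try by lia.
  by rewrite cats0 map_rev.
have {w3} w3 : size (spine (s3 m.+4)) = 4 * b.
  by rewrite w3 /s2 updE spine_un size_nseq /b /width; lia.
pose s4 := upd s3 m (tl (s3 m)).
have x4 : exec_le s3 (Assign m (ETl (Var m))) s4 3 by exact: le_assign.
have s4m : s4 m = tree_of_bits (B ++ code_nat k) by rewrite /s4 updE v3.
have s4N y : y != m -> s4 y = s3 y by move=> ?; rewrite /s4 updN.
have [s5 [x5 w5 f5]] := pow2P m.+2 s4.
have s4W : size (spine (s4 m.+4)) = 4 * b by rewrite s4N ?w3 //; lia.
rewrite s4W in x5 w5.
pose s6 := upd s5 m.+4.+1 [@ s5 m.+1; s5 m].
have x6 : exec_le s5 (Assign m.+4.+1 (ECons (Var m.+1) (ECons (Var m) ENil))) s6 6.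
  exact: le_assign.
have c6 : size (spine (s6 m.+2)) = 2 ^ (4 * b) by rewrite /s6 updN //; lia.
have clk_lt : m.+2 < m.+4.+1 by lia.
have [s7 [x7 v7 f7]] := compileP f_parse clk_lt c6.
have s51 : s5 m.+1 = tree_of_bits (rev (bits n)).
  rewrite f5 ?s4N //; last by lia.
  have spineK (t : tree) : of_seq (spine t) = t by elim: t => //= a _ c ->.
  by rewrite -[LHS]spineK rb3 tree_of_bitsE.
have s5m : s5 m = tree_of_bits (B ++ code_nat k) by rewrite f5 ?s4m //; lia.
have := @run_parse (2 ^ (4 * b)) (rev (bits n)) B k.
rewrite bval_rev_bits size_rev -/(width n) -/b => /(_ (leqnn _)).
have sB : size B = size (nat_pairs n) by rewrite -pairsE !size_map.
move=> /(_ sB); rewrite -/(ds_edges G) => run7.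
rewrite {1}/s6 updE s51 s5m run7 in v7.
pose s8 := upd s7 m (tl (s7 m.+4.+1)).
have x8 : exec_le s7 (Assign m (ETl (Var m.+4.+1))) s8 3 by exact: le_assign.
pose s9 := upd s8 m.+4 (hd (s8 m.+4.+1)).
have x9 : exec_le s8 (Assign m.+4 (EHd (Var m.+4.+1))) s9 3 by exact: le_assign.
have s85 : s8 m.+4.+1 = s7 m.+4.+1 by rewrite /s8 updN //; lia.
have [s10 [x10 w10 f10]] := pow2P m.+2 s9.
have w9 : size (spine (s9 m.+4)) = log_clock b.
  by rewrite /s9 updE s85 v7 -[hd _]/(un _) spine_un size_nseq.
rewrite w9 -/X in x10 w10.
pose s11 := upd s10 m.+4.+1 [@ s10 m].
have x11 : exec_le s10 (Assign m.+4.+1 (ECons (Var m) ENil)) s11 4 by exact: le_assign.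
have c11 : size (spine (s11 m.+2)) = X by rewrite /s11 updN //; lia.
have [s12 [x12 v12 f12]] := compileP f_gen clk_lt c11.
have s10m : s10 m = data_tree n (cut_k b n k) b (blocksize b) (nblocks b) (ds_edges G).
  rewrite f10; last by lia.
  by rewrite /s9 updN ?/s8 ?updE ?v7 //; lia.
rewrite {1}/s11 updE s10m (run_ds_gen (G, k)) in v12.
pose s13 := upd s12 0 (s12 m.+4.+1).
have x13 : exec_le s12 (Assign 0 (Var m.+4.+1)) s13 2 by exact: le_assign.
have agree y : y < m -> init (gtc_code (ds_instance (G, k))) y = s13 y.
  move=> ym; rewrite /s13 /init /upd; case: eqP => [//|/eqP y0].
  rewrite f12; last by lia.
  rewrite /s11 updN; last by lia.
  rewrite f10; last by lia.
  rewrite /s9 updN /s8 ?updN ?f7; try by lia.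
  rewrite /s6 updN ?f5 ?s4N ?f3 /s2 ?updN /s1 ?updN ?s0E //; lia.
have [s14 x14 E14] := exec_agree exA (leq_maxl _ _ : cvars A <= m) agree.
have [T' x T'le] := le_seq x1 (le_seq x2 (le_seq x3 (le_seq x4 (le_seq x5 (le_seq x6
  (le_seq x7 (le_seq x8 (le_seq x9 (le_seq x10 (le_seq x11 (le_seq x12
  (le_seq x13 (ex_intro2 _ _ T x14 (leqnn T)))))))))))))).
exists T'; first by exists s14 => //; rewrite -E14.
apply: leq_trans T'le _.
have := Hp _ X (dp + dg).+1 h1 X0 ltac:(lia).
have := Hg _ X (dp + dg).+1 (leqnn X) X0 ltac:(lia).
have bX : b <= X.
  apply: leq_trans (ltnW (ltn_expl b (isT : 1 < 2))) (leq_trans _ h1).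
  by rewrite leq_exp2l //; lia.
have XX : X <= X ^ (dp + dg).+1 by rewrite expnS leq_pmulr // expn_gt0 X0.
have sb : size (bits n) <= b by rewrite /b /width.
move: (X ^ _) XX => Y XY.
rewrite !mulnDl; lia.
Qed.

(** * Asymptotics *)

Lemma sqr_le_expn b : b * b <= 2 * 2 ^ b.
Proof.
elim: b => // b IH; have [b3|b3] := leqP b 2; first by case: b b3 IH => [|[|[]]].
by rewrite expnS; nia.
Qed.

(** With [q] the block size, [b ^ 2 * q] is at most [2 ^ b + b ^ 2], hence at most [3 * 2 ^ b]. The
    product is [2 * b ^ 2 * q + 4 * b ^ 2], at most [6 * 2 ^ b + 8 * 2 ^ b]. *)
Lemma width_log_clock b : 2 <= b -> b * log_clock b <= 14 * 2 ^ b.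
Proof.
move=> b2; have := blocks_le b; have := sqr_le_expn b; rewrite /nblocks log_clockE //.
by move: (2 ^ b) (blocksize b) => X q h1 h2; nia.
Qed.

Lemma width_exponent b : 2 <= b ->
  2 * 2 ^ b <= (blocksize b * b + blocksize b * b) * b <= 6 * 2 ^ b.
Proof.
move=> b2; have := blocks_le b; have := cover_blocks b2; have := sqr_le_expn b.
rewrite /nblocks; move: (2 ^ b) (blocksize b) => X q h1 h2 h3.
by apply/andP; split; nia.
Qed.

Lemma expn_width n : 0 < n -> 2 ^ width n <= 4 * n.
Proof.
move=> n0; rewrite /width size_bits !expnS mulnA leq_mul2l /=.
exact: trunc_logP.
Qed.

Lemma width_ge m n : 2 ^ m <= n -> m <= width n.
Proof.
move=> mn; rewrite /width size_bits; apply: leq_trans (leqW (leqnSn _)).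
by rewrite -(@trunc_expnK 2 m) //; apply: leq_trunc_log.
Qed.

Import GRing.Theory.

Lemma horner_nat_le (p : {poly nat}) : exists C d, forall r X, r <= X -> 0 < X ->
  (p.[r])%R <= C * X ^ d.
Proof.
exists (sumn p), (size p) => r X rX X0; rewrite /horner.
elim: (polyseq p) => //= a s IH.
rewrite -[(_ + _)%R]/(_ + _) -[(_ * _)%R]/(_ * _) expnS.
have := leq_mul IH rX; have : 0 < X ^ size s by rewrite expn_gt0 X0.
move: (X ^ size s) (sumn s) => Y S Y0 h.
have : a <= a * (X * Y) by rewrite leq_pmulr // muln_gt0 X0.
nia.
Qed.

Import Order.TTheory GRing.Theory Num.Theory.
Import numFieldNormedType.Exports.
Local Open Scope classical_set_scope.
Local Open Scope ring_scope.

Section Asymptotics.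
Variable R : realType.
Implicit Types f g h : nat -> R.

Lemma littleo_natP f g : f =o_\oo g <->
  forall eps : R, 0 < eps -> exists n0, forall n, (n0 <= n)%N -> `|f n| <= eps * `|g n|.
Proof.
split=> [/eqoP fg eps /fg [n0 _ H]|H]; first by exists n0 => n /H.
by apply/eqoP => eps /H [n0 {}H]; exists n0 => // n /= /H.
Qed.

Lemma le_width (c : R) : exists n0, forall n, (n0 <= n)%N ->
  (0 < n)%N /\ c <= (width n)%:R.
Proof.
exists (2 ^ (Num.truncn `|c|).+1)%N => n hn; split.
  by apply: leq_trans hn; rewrite expn_gt0.
apply: le_trans (ler_norm c) _; apply: le_trans (ltW (truncnS_gt _)) _.
by rewrite ler_nat width_ge.
Qed.

(** The width tends to infinity, so a bound of order [n / width n] is sublinear. *)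
Lemma littleo_width h (c : R) :
  (exists n0, forall n, (n0 <= n)%N -> `|h n| * (width n)%:R <= c * n%:R) ->
  h =o_\oo (fun n : nat => n%:R : R).
Proof.
move=> [n0 H]; apply/littleo_natP => eps eps0.
have [n1 H1] := le_width (`|c| / eps); exists (maxn n0 n1) => n.
rewrite geq_max => /andP[/H h0 /H1[n_gt0 h1]].
have b0 : 0 < (width n)%:R :> R by rewrite ltr0n.
rewrite -(ler_pM2r b0) (le_trans h0) // (@ger0_norm _ n%:R) //.
apply: (@le_trans _ _ (`|c| * n%:R)); first by rewrite ler_wpM2r // ler_norm.
by rewrite mulrAC ler_wpM2r // mulrC -ler_pdivrMr.
Qed.

Lemma powR2_nat n : 2 `^ n%:R = (2 ^ n)%:R :> R.
Proof. by rewrite powR_mulrn // natrX. Qed.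

Lemma log_clock_littleo : (fun n => (log_clock (width n))%:R : R) =o_\oo
  (fun n : nat => n%:R : R).
Proof.
(* 56 is 14 from [width_log_clock] times 4 from [expn_width]. *)
apply: (@littleo_width _ 56); exists 1%N => n n1.
rewrite ger0_norm // -!natrM ler_nat mulnC.
have := width_log_clock (width_ge2 n); have := expn_width n1; lia.
Qed.

(** Common to both cases: it remains to show that the exponent of the solver, on the instances
    produced, is sublinear in the number of vertices of the original graph. *)
Lemma ds_solver (A : cmd) (e : nat -> R) (q : {poly nat}) :
  e =o_\oo (fun n : nat => n%:R : R) ->
  (forall J : graph * nat, exists b T,
     [/\ outputs A (gtc_code (ds_instance J)) b T, b <-> gtc_yes (ds_instance J) &
         T%:R <= 2 `^ e (nverts J.1) * (q.[bit_size (ds_instance J)])%:R]) ->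
  exists (B : cmd) (h : nat -> R),
    h =o_\oo (fun n : nat => n%:R : R) /\
    solves_in_time B ds_code ds_yes (fun J => 2 `^ h (nverts J.1)).
Proof.
move=> eo solA; have [B [C [d HB]]] := reduction A.
have [C' [d' Hq]] := horner_nat_le q.
pose W n := log_clock (width n).
pose c := (C + C' * 40 ^ d')%N; pose a := (d + 4 * d')%N.
(* The constant factors are absorbed by [2 ^ c]. The powers of the clock come from the reduction,
   with degree [d], and from the polynomial in the bit size, with degree [4 * d']. The absolute
   value covers negative [e n]. *)
exists B, (fun n => c%:R + a%:R * (W n)%:R + `|e n|); split.
  move/littleo_natP: eo => eo; move/littleo_natP: log_clock_littleo => Wo.
  apply/littleo_natP => eps eps0.
  have eps3 : 0 < eps / 3 by rewrite divr_gt0.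
  have [n1 H1] := eo _ eps3.
  have [|n2 H2] := Wo (eps / 3 / a.+1%:R); first by rewrite divr_gt0.
  exists (maxn (maxn n1 n2) (Num.truncn (c%:R / (eps / 3))).+1) => n.
  rewrite !geq_max => /andP[/andP[/H1 h1 /H2 h2] h3].
  have hc : c%:R <= eps / 3 * n%:R.
    rewrite mulrC -ler_pdivrMr //; apply/ltW/(lt_le_trans (truncnS_gt _)).
    by rewrite ler_nat.
  rewrite (@ger0_norm _ n%:R) // in h1 h2 *.
  rewrite ger0_norm in h2; last by [].
  have ha : a%:R * (W n)%:R <= eps / 3 * n%:R.
    apply: (@le_trans _ _ (a.+1%:R * (W n)%:R)).
      by rewrite ler_wpM2r // ler_nat.
    rewrite mulrC -ler_pdivlMr //; apply: le_trans h2 _.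
    by rewrite mulrAC.
  rewrite ger0_norm; last by rewrite !addr_ge0 // mulr_ge0.
  lra.
move=> J; have [b [T [outA yA leT]]] := solA J.
have [T' outB leT'] := HB J b T outA.
exists b, T'; split=> //; first by rewrite yA; exact: ds_instance_yes.
set n := nverts J.1 in leT leT' *.
have X0 : (0 < 2 ^ W n)%N by rewrite expn_gt0.
have := Hq _ _ (ds_instance_size J) _; rewrite -/n -/(W n) => {}Hq.
have {}Hq : (q.[bit_size (ds_instance J)] <= C' * 40 ^ d' * (2 ^ W n) ^ (4 * d'))%N.
  by rewrite -mulnA expnM -expnMn; apply: Hq; rewrite muln_gt0 expn_gt0 X0.
set y := (2 : R) `^ `|e n|.
have y1 : 1 <= y by rewrite -(powRr0 2) ler_powR // ler1n.
have ey : 2 `^ e n <= y by rewrite ler_powR ?ler1n // ler_norm.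
have E : 2 `^ (c%:R + a%:R * (W n)%:R + `|e n|) = (2 ^ c * (2 ^ W n) ^ a)%:R * y.
  rewrite powRD ?pnatr_eq0 ?implybT // powRD ?pnatr_eq0 ?implybT //.
  by rewrite -natrM !powR2_nat -natrM (mulnC a) expnM.
rewrite E; apply: (@le_trans _ _ ((C * (2 ^ W n) ^ d)%:R + T%:R)).
  by rewrite -natrD ler_nat.
have cle : (C + C' * 40 ^ d' <= 2 ^ c)%N by apply/ltnW/ltn_expl.
have da : ((2 ^ W n) ^ d <= (2 ^ W n) ^ a)%N by rewrite leq_pexp2l // leq_addr.
have da' : ((2 ^ W n) ^ (4 * d') <= (2 ^ W n) ^ a)%N by rewrite leq_pexp2l // leq_addl.
have y0 : 0 <= y by rewrite powR_ge0.
apply: (@le_trans _ _ ((C * (2 ^ W n) ^ a)%:R * y + (C' * 40 ^ d' * (2 ^ W n) ^ a)%:R * y)).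
  apply: lerD.
    apply: (@le_trans _ _ (C * (2 ^ W n) ^ a)%:R); first by rewrite ler_nat leq_mul2l da orbT.
    by rewrite ler_peMr.
  apply: le_trans leT _; rewrite mulrC; apply: ler_pM; rewrite ?powR_ge0 ?ler0n //.
  by rewrite ler_nat; apply: leq_trans Hq _; rewrite leq_mul2l da' orbT.
rewrite -mulrDl ler_wpM2r // -natrD ler_nat -mulnDl leq_mul2r cle orbT //.
Qed.

End Asymptotics.

(** * The two running times on the produced instances *)

Section Exponents.
Variable R : realType.

Definition order_of (n : nat) : nat := (nblocks (width n) + nblocks (width n)).+2.

(** This is the largest forbidden distance, one less than the number of colors. *)
Definition last_color (b : nat) : nat :=
  (2 ^ (blocksize b * b + blocksize b * b)).-1.

Lemma order_of_bounds n : (width n <= order_of n <= 4 * (width n * width n))%N.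
Proof.
by have := width_ge2 n; rewrite /order_of /nblocks => b2; apply/andP; split; nia.
Qed.

Lemma sqrt_expn_width b : exists y : R,
  [/\ y = 2 `^ (b%:R / 2), 0 < y, y * y = (2 ^ b)%:R & b%:R <= 2 * y].
Proof.
have y0 : 0 < 2 `^ (b%:R / 2) :> R by rewrite powR_gt0.
have yy : 2 `^ (b%:R / 2) * 2 `^ (b%:R / 2) = (2 ^ b)%:R :> R.
  rewrite -powRD ?pnatr_eq0 ?implybT // -powR2_nat; congr (_ `^ _); lra.
exists (2 `^ (b%:R / 2)); split=> //.
rewrite -(@ler_pXn2r _ 2) ?nnegrE ?mulr_ge0 ?(ltW y0) //.
rewrite !expr2 mulrACA yy -!natrM ler_nat.
by have := sqr_le_expn b; lia.
Qed.

(** The order is at most [4 * b ^ 2], so its root is at most [2 * b]. With the constant 1/4, [f] is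
    at most [b / 2] there. With [y] the root of [2 ^ b], the exponent times [b] is at most
    [2 * y ^ 2], hence at most [8 * n]. *)
Lemma sqrt_exponent (f : nat -> R) :
  f =o_\oo (fun n : nat => Num.sqrt (n%:R : R)) ->
  (fun n => 2 `^ f (order_of n)) =o_\oo (fun n : nat => n%:R : R).
Proof.
move/littleo_natP => /(_ (4%:R^-1)) [|n0 H]; first by rewrite invr_gt0.
apply: (@littleo_width _ _ 8).
have [n1 H1] := le_width (n0%:R : R); exists n1 => n /H1[n_gt0].
rewrite ler_nat => bn0; have /andP[bN Nb] := order_of_bounds n.
have := H (order_of n) (leq_trans bn0 bN).
set b := width n in bn0 bN Nb *.
have [y [Ey y0 yy by2]] := sqrt_expn_width b.
have sN : Num.sqrt (order_of n)%:R <= 2 * b%:R :> R.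
  rewrite -(@ler_pXn2r _ 2) ?nnegrE ?sqrtr_ge0 ?mulr_ge0 // sqr_sqrtr // exprMn.
  by rewrite -!natrX -natrM ler_nat -mulnn.
rewrite (@ger0_norm _ (Num.sqrt _)) ?sqrtr_ge0 // => fN.
have fb : f (order_of n) <= b%:R / 2 by have := ler_norm (f (order_of n)); lra.
have ey : 2 `^ f (order_of n) <= y by rewrite Ey ler_powR // ler1n.
have X4 : (2 ^ b)%:R <= 4 * n%:R :> R by rewrite -natrM ler_nat expn_width.
rewrite ger0_norm ?powR_ge0 //.
apply: (@le_trans _ _ (y * (2 * y))); first by apply: ler_pM; rewrite ?powR_ge0.
by rewrite mulrCA yy; lra.
Qed.

Lemma ln2_bounds : 2^-1 <= ln (2 : R) <= 1.
Proof.
have l2 : ln (2 : R) <= 1 by have := @le_ln1Dx R 1; rewrite -[1 + 1]/2; apply; lra.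
rewrite l2 andbT -ler_expR lnK ?posrE //.
have : 1 + - 2^-1 <= expR (- 2^-1 : R) := expR_ge1Dx _.
rewrite expRN => h; have e0 : 0 < expR (2^-1 : R) by exact: expR_gt0.
rewrite -(ler_pV2) ?inE ?unitfE ?gt_eqF //; lra.
Qed.

(** [w] is at least the root [y] of [2 ^ b], and the logarithm is at least [w / 4]. So the iterated
    logarithm is at least [(b / 2 - 2) * ln 2], hence at least [b / 4 - 1], which reaches [b / 8]
    from [b = 8] on. *)
Lemma lnln_last_color b (w := (blocksize b * b + blocksize b * b)%N) : (8 <= b)%N ->
  [/\ 0 <= ln ((last_color b)%:R : R), ln ((last_color b)%:R : R) <= w%:R &
      b%:R / 8 <= ln (ln ((last_color b)%:R : R))].
Proof.
move=> b8; have /andP[ln2 ln2'] := ln2_bounds.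
have /andP[wb _] := width_exponent (leq_trans (isT : (2 <= 8)%N) b8).
rewrite -/w in wb; rewrite /last_color -/w.
have w2 : (2 <= w)%N.
  rewrite leqNgt; apply/negP => w1; have := ltn_expl b (isT : (1 < 2)%N); nia.
have Ew : (2 ^ w = 2 * 2 ^ w.-1)%N by rewrite -expnS prednK //; lia.
have Y0 : (0 < 2 ^ w.-1)%N by rewrite expn_gt0.
have lnX m : ln ((2 ^ m)%:R : R) = m%:R * ln 2.
  by rewrite natrX lnXn // mulr_natl.
set l : R := _%:R.
have l0 : 0 < l by rewrite ltr0n Ew; lia.
have lo : w.-1%:R / 2 <= ln l.
  apply: (@le_trans _ _ (w.-1%:R * ln 2)); first by rewrite ler_wpM2l.
  by rewrite -lnX ler_ln ?posrE // ?ltr0n // /l ler_nat Ew; lia.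
have hi : ln l <= w%:R.
  apply: (@le_trans _ _ (w%:R * ln 2)); last by rewrite ler_piMr.
  by rewrite -lnX ler_ln ?posrE // ?ltr0n ?expn_gt0 // /l ler_nat leq_pred.
have [y [Ey y0 yy by2]] := sqrt_expn_width b.
have wy : y <= w%:R.
  have h : 2 * (y * y) <= w%:R * b%:R by rewrite yy -!natrM ler_nat.
  have : w%:R * b%:R <= w%:R * (2 * y) by rewrite ler_wpM2l.
  move=> h'; rewrite -(ler_pM2r y0); lra.
have w4 : w%:R / 4 <= w.-1%:R / 2 :> R.
  have : w%:R <= 2 * w.-1%:R :> R by rewrite -natrM ler_nat; lia.
  lra.
have ly : y / 4 <= ln l by lra.
split=> //; first by apply: le_trans ly; rewrite divr_ge0 // ltW.
have y4 : 0 < y / 4 by rewrite divr_gt0.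
apply: (@le_trans _ _ (ln (y / 4))); last by rewrite ler_ln ?posrE // (lt_le_trans y4).
rewrite ln_div ?posrE // Ey ln_powR (_ : 4 = 2 ^+ 2); last by rewrite -natrX.
rewrite lnXn // [ln 2 *+ 2]mulr2n; have b8' : 8 <= b%:R :> R by rewrite ler_nat.
have : 0 <= (b%:R / 2 - 2) * (ln 2 - 2^-1 : R) by apply: mulr_ge0; lra.
lra.
Qed.

(** The bound [b / 8] on the iterated logarithm gives [f] at most [64 * w / b ^ 2]. Multiplied by
    the order, at most [4 * b ^ 2], this is [256 * w]; and [w * b] is at most [24 * n]. Hence
    6144. *)
Lemma log_exponent (f : nat -> R) :
  f =o_\oo (fun l : nat => ln (l%:R : R) / ln (ln (l%:R : R)) ^+ 2) ->
  (fun n => (order_of n)%:R * f (last_color (width n))) =o_\oo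
  (fun n : nat => n%:R : R).
Proof.
move/littleo_natP => /(_ 1 ltr01) [n0 H].
apply: (@littleo_width _ _ 6144).
have [n1 H1] := le_width ((n0 + 8)%:R : R); exists n1 => n /H1[n_gt0].
rewrite ler_nat => bn0; have /andP[_ Nb] := order_of_bounds n.
set b := width n in bn0 Nb *; have b2 : (2 <= b)%N := width_ge2 n.
have b8 : (8 <= b)%N by lia.
have [ln0 lnw lnln] := lnln_last_color b8.
have /andP[_ wb] := width_exponent b2.
set w := (blocksize b * b + blocksize b * b)%N in lnw wb *.
have ll : (n0 <= last_color b)%N.
  have : (b <= w)%N by rewrite /w -mulnDl leq_pmull // addn_gt0.
  by rewrite /last_color -/w; have := ltn_expl w (isT : (1 < 2)%N); lia.
have {H} := H _ ll; rewrite mul1r => fl.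
set L := ln (last_color b)%:R in ln0 lnw lnln fl.
have b0 : 0 < b%:R :> R by rewrite ltr0n; lia.
have lnln0 : 0 < ln L by apply: lt_le_trans lnln; rewrite divr_gt0.
have fw : `|f (last_color b)| * (b%:R * b%:R) <= 64 * w%:R.
  have Lge0 : 0 <= L / ln L ^+ 2 by rewrite divr_ge0 ?exprn_ge0 ?(ltW lnln0).
  rewrite (ger0_norm Lge0) in fl.
  have : L / ln L ^+ 2 * (b%:R * b%:R) <= 64 * L.
    rewrite mulrAC ler_pdivrMr ?exprn_gt0 // (mulrC 64) -mulrA ler_wpM2l //.
    rewrite expr2; nra.
  have : `|f (last_color b)| * (b%:R * b%:R) <= L / ln L ^+ 2 * (b%:R * b%:R).
    by rewrite ler_wpM2r ?mulr_ge0.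
  lra.
rewrite normrM ger0_norm //.
have N4 : (order_of n)%:R <= 4 * (b%:R * b%:R) :> R by rewrite -!natrM ler_nat.
have wb' : w%:R * b%:R <= 6 * (4 * n%:R) :> R.
  rewrite -!natrM ler_nat; have := expn_width n_gt0; rewrite -/b; lia.
apply: (@le_trans _ _ (4 * (64 * w%:R) * b%:R)); last by lra.
rewrite ler_wpM2r //.
apply: (@le_trans _ _ (4 * (b%:R * b%:R) * `|f (last_color b)|)).
  by rewrite ler_wpM2r.
by rewrite -mulrA ler_wpM2l // mulrC.
Qed.

End Exponents.

Theorem theorem3 (R : realType) :
  (exists (A : cmd) (f : nat -> R) (q : {poly nat}),
     f =o_\oo (fun n : nat => Num.sqrt (n%:R : R)) /\
     solves_in_time A gtc_code gtc_yes
       (fun I => 2 `^ (2 `^ f (nverts I)) * (q.[bit_size I])%:R)) \/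
  (exists (A : cmd) (f : nat -> R) (q : {poly nat}),
     f =o_\oo (fun l : nat => ln (l%:R : R) / ln (ln (l%:R : R)) ^+ 2) /\
     solves_in_time A gtc_code gtc_yes
       (fun I => 2 `^ ((nverts I)%:R * f (max_forbidden I)) *
                 (q.[bit_size I])%:R)) ->
  exists (B : cmd) (h : nat -> R),
    h =o_\oo (fun n : nat => n%:R : R) /\
    solves_in_time B ds_code ds_yes (fun J => 2 `^ h (nverts J.1)).
Proof.
case=> [[A [f [q [fo solA]]]]|[A [f [q [fo solA]]]]].
  (* The number of vertices of [ds_instance J] is [order_of (nverts J.1)] by computation. *)
  by apply: (ds_solver (sqrt_exponent fo)) => J; exact: solA.
apply: (ds_solver (log_exponent fo)) => J.
have := solA (ds_instance J); rewrite ds_instance_max; exact.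
Qed.
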